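(* Let $K\subset[-1,1]$ be compact, regarded as a subset of the line $\{y=0\}$ in $\mathbb{R}^2$. Then there exist functions $\Lambda^\pm\in C^\infty(B_1)\setminus C^\omega(B_1)$ (depending on $K$) and a solution $u$ of the two-phase Bernoulli problem in $B_1\subset\mathbb{R}^2$ with coefficients $\Lambda^\pm$ (as defined in the context) such that $\mathcal B(u)=\partial K$.
   Context: $C^\omega$ denotes real-analytic functions. Given positive functions $\Lambda^\pm$ on $B_1$, for $u\in C^{0,1}(B_1)$ set $u^\pm:=\max(\pm u,0)$ and $\Omega_\pm:=\{\pm u>0\}\cap B_1$. We say that $u$ is a solution of the two-phase Bernoulli problem in $B_1$ with coefficients $\Lambda^\pm$ if, for some $\alpha\in(0,1)$, the free boundaries $\partial\Omega_\pm\cap B_1$ are $C^{1,\alpha}$-regular, $u^\pm\in C^{1,\alpha}(\overline{\Omega_\pm}\cap B_1)$, and $\Delta u^\pm=0$ in $\Omega_\pm$; $u^\pm=0$ on $\partial\Omega_\pm\cap B_1$; $|\nabla u^\pm|^2=\Lambda^\pm$ on $(\partial\Omega_\pm\setminus\partial\Omega_\mp)\cap B_1$; $|\nabla u^\pm|^2\ge\Lambda^\pm$ on $\partial\Omega_+\cap\partial\Omega_-\cap B_1$; and $|\nabla u^+|^2-|\nabla u^-|^2=\Lambda^+-\Lambda^-$ on $\partial\Omega_+\cap\partial\Omega_-\cap B_1$ (gradients on the boundary being boundary values from $\overline{\Omega_\pm}$). The branching set is $\mathcal B(u):=\partial\Omega_+\cap\partial\Omega_-\cap\overline{\mathrm{int}(\{u=0\})}$.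 *)

(* Defs.v *)
From Stdlib Require Import Reals Lra List.
From Coquelicot Require Import Coquelicot.
Open Scope R_scope.

Definition pt := (R * R)%type.

Definition edist (p q : pt) : R :=
  sqrt ((fst p - fst q) ^ 2 + (snd p - snd q) ^ 2).

Definition eball (c : pt) (r : R) (p : pt) : Prop := edist p c < r.
Definition Bone : pt -> Prop := eball (0, 0) 1.

Definition closure2 (S : pt -> Prop) (p : pt) : Prop :=
  forall e, 0 < e -> exists q, S q /\ edist p q < e.
Definition interior2 (S : pt -> Prop) (p : pt) : Prop :=
  exists e, 0 < e /\ forall q, edist p q < e -> S q.
Definition boundary2 (S : pt -> Prop) (p : pt) : Prop :=
  closure2 S p /\ closure2 (fun q => ~ S q) p.

Definition closure1 (S : R -> Prop) (x : R) : Prop :=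
  forall e, 0 < e -> exists y, S y /\ Rabs (x - y) < e.
Definition boundary1 (S : R -> Prop) (x : R) : Prop :=
  closure1 S x /\ closure1 (fun y => ~ S y) x.
Definition closed1 (S : R -> Prop) : Prop := forall x, closure1 S x -> S x.

(* Partial derivatives (total operators; meaningful when they exist). *)
Definition Dx (f : pt -> R) (p : pt) : R := Derive (fun t => f (t, snd p)) (fst p).
Definition Dy (f : pt -> R) (p : pt) : R := Derive (fun t => f (fst p, t)) (snd p).

Fixpoint pdw (w : list bool) (f : pt -> R) : pt -> R :=
  match w with
  | nil => f
  | b :: w' => if b then Dx (pdw w' f) else Dy (pdw w' f)
  end.

Definition ex_partials (f : pt -> R) (p : pt) : Prop :=
  ex_derive (fun t => f (t, snd p)) (fst p) /\
  ex_derive (fun t => f (fst p, t)) (snd p).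

Definition Ck_on (k : nat) (f : pt -> R) (U : pt -> Prop) : Prop :=
  forall w : list bool, (length w <= k)%nat -> forall p, U p ->
    continuous (pdw w f) p /\ ((length w < k)%nat -> ex_partials (pdw w f) p).

Definition smooth_on (f : pt -> R) (U : pt -> Prop) : Prop :=
  forall k, Ck_on k f U.

Definition analytic_on (f : pt -> R) (U : pt -> Prop) : Prop :=
  forall p, U p -> exists r, 0 < r /\ exists a : nat -> nat -> R,
    forall q, edist q p < r ->
      let dx := fst q - fst p in let dy := snd q - snd p in
      ex_series (fun n => sum_f_R0 (fun i => Rabs (a i (n - i)%nat)
                                * Rabs dx ^ i * Rabs dy ^ (n - i)) n) /\
      f q = Series (fun n => sum_f_R0 (fun i => a i (n - i)%nat
                                * dx ^ i * dy ^ (n - i)) n).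

Definition harmonic_on (f : pt -> R) (U : pt -> Prop) : Prop :=
  Ck_on 2 f U /\
  forall p, U p -> pdw (true :: true :: nil) f p + pdw (false :: false :: nil) f p = 0.

Definition lipschitz_B1 (u : pt -> R) : Prop :=
  exists L, forall p q, Bone p -> Bone q -> Rabs (u p - u q) <= L * edist p q.

Definition C1alpha_R (alpha : R) (g : R -> R) : Prop :=
  exists (gd : R -> R), (forall t, is_derive g t (gd t)) /\
    exists C, forall s t, Rabs (gd s - gd t) <= C * Rpower (Rabs (s - t)) alpha.

(* The boundary of Omega is C^{1,alpha}-regular inside B_1: near every point
   x0 of (boundary Omega) /\ B_1, after a rotation, Omega is the open
   supergraph of a C^{1,alpha} function. *)
Definition C1alpha_boundary (alpha : R) (Om : pt -> Prop) : Prop :=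
  forall x0, boundary2 Om x0 -> Bone x0 ->
    exists r, 0 < r /\ exists (theta : R) (g : R -> R),
      C1alpha_R alpha g /\
      forall q, edist q x0 < r ->
        Bone q /\
        (Om q <->
           cos theta * (fst q - fst x0) + sin theta * (snd q - snd x0)
           > g (- sin theta * (fst q - fst x0) + cos theta * (snd q - snd x0))).

(* f in C^{1,alpha}(closure Omega /\ B_1): f has partial derivatives in Omega
   given by G, and G extends to closure Omega /\ B_1 as a (locally)
   alpha-Hoelder continuous map.  G on the free boundary is then the boundary
   value of the gradient from closure Omega. *)
Definition C1alpha_upto (alpha : R) (f : pt -> R) (Om : pt -> Prop)
    (G : pt -> pt) : Prop :=
  (forall p, Om p ->
     is_derive (fun t => f (t, snd p)) (fst p) (fst (G p)) /\
     is_derive (fun t => f (fst p, t)) (snd p) (snd (G p))) /\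
  (forall p0, closure2 Om p0 -> Bone p0 ->
     exists r, 0 < r /\ exists C, forall p q,
       closure2 Om p -> Bone p -> edist p p0 < r ->
       closure2 Om q -> Bone q -> edist q p0 < r ->
       edist (G p) (G q) <= C * Rpower (edist p q) alpha).

Definition sqnorm (v : pt) : R := fst v ^ 2 + snd v ^ 2.

Definition upos (u : pt -> R) : pt -> R := fun p => Rmax (u p) 0.
Definition uneg (u : pt -> R) : pt -> R := fun p => Rmax (- u p) 0.
Definition Omp (u : pt -> R) : pt -> Prop := fun p => u p > 0 /\ Bone p.
Definition Omm (u : pt -> R) : pt -> Prop := fun p => - u p > 0 /\ Bone p.

Definition two_phase_solution (u Lp Lm : pt -> R) : Prop :=
  lipschitz_B1 u /\
  exists alpha, 0 < alpha < 1 /\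
  C1alpha_boundary alpha (Omp u) /\ C1alpha_boundary alpha (Omm u) /\
  exists Gp Gm : pt -> pt,
    C1alpha_upto alpha (upos u) (Omp u) Gp /\
    C1alpha_upto alpha (uneg u) (Omm u) Gm /\
    harmonic_on (upos u) (Omp u) /\ harmonic_on (uneg u) (Omm u) /\
    (forall p, boundary2 (Omp u) p -> Bone p -> upos u p = 0) /\
    (forall p, boundary2 (Omm u) p -> Bone p -> uneg u p = 0) /\
    (forall p, boundary2 (Omp u) p -> ~ boundary2 (Omm u) p -> Bone p ->
       sqnorm (Gp p) = Lp p) /\
    (forall p, boundary2 (Omm u) p -> ~ boundary2 (Omp u) p -> Bone p ->
       sqnorm (Gm p) = Lm p) /\
    (forall p, boundary2 (Omp u) p -> boundary2 (Omm u) p -> Bone p ->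
       sqnorm (Gp p) >= Lp p /\ sqnorm (Gm p) >= Lm p /\
       sqnorm (Gp p) - sqnorm (Gm p) = Lp p - Lm p).

(* Branching set B(u) = dOmega+ /\ dOmega- /\ closure(int {u = 0}),
   where {u = 0} is taken inside B_1 (the domain of u). *)
Definition branching_set (u : pt -> R) (p : pt) : Prop :=
  boundary2 (Omp u) p /\ boundary2 (Omm u) p /\
  closure2 (interior2 (fun q => Bone q /\ u q = 0)) p.

(* Main.v *)
(** Replacing [K] by its boundary [Z], which is closed with empty interior, it suffices to open a
    gap exactly over the complement of [Z].  Take a smooth [psi >= 0] on the line with zero set [Z] and
    its harmonic extension [W] to the upper half-plane, scaled so that [|W_y| <= 1/2].  The function
    [U = y - W] is harmonic for [y > 0], increasing in [y], and [U (x, 0) = - psi x <= 0]; hence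
    [{U > 0}] is the supergraph of some [g >= 0] with [g x = 0] iff [x] lies in [Z].  The
    solution is [U^+] above and its odd reflection below, and the coefficients are [|grad U|^2] and
    its reflection, so that the gradient conditions hold with equality.

    The harmonic extension comes from the cosine series of [psi]: its coefficients decrease rapidly,
    so replacing [exp (- n y)] by [E (n y)], with [E] smooth, bounded together with its derivatives
    and equal to [exp (- t)] for [t >= 0], extends [W] to a smooth function on the whole plane.

    Analyticity of the coefficients is destroyed, if need be, by adding a flat function supported
    away from the free boundary. *)

Require Import Defs.
From Stdlib Require Import Reals Lra Lia ClassicalEpsilon FunctionalExtensionality Cantor.
From Coquelicot Require Import Coquelicot.
Open Scope R_scope.

(** * Smooth functions of one variable *)

Fixpoint Cn (n : nat) (f : R -> R) : Prop :=
  match n with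
  | O => True
  | S m => exists f' : R -> R, (forall x : R, is_derive f x (f' x)) /\ Cn m f'
  end.

Lemma Cn_le n m f : (m <= n)%nat -> Cn n f -> Cn m f.
Proof.
  revert m f; induction n as [|n IH]; intros [|m] f H Hf; simpl; auto; try lia.
  destruct Hf as [f' [H1 H2]]. exists f'; split; auto. apply IH; auto; lia.
Qed.

Lemma Cn_ext n f g : (forall x, f x = g x) -> Cn n f -> Cn n g.
Proof. intros H; replace g with f; auto. now apply functional_extensionality. Qed.

Lemma Cn_const n c : Cn n (fun _ => c).
Proof.
  revert c; induction n; intros c; simpl; auto.
  exists (fun _ => 0); split; auto. intros x; auto_derive; auto.
Qed.

Lemma Cn_plus n f g : Cn n f -> Cn n g -> Cn n (fun x => f x + g x).
Proof.
  revert f g; induction n as [|n IH]; intros f g; simpl; auto.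
  intros [f' [Hf Hf']] [g' [Hg Hg']]. exists (fun x => f' x + g' x); split; auto.
  intros x; apply (is_derive_plus f g x); auto.
Qed.

Lemma Cn_mult n f g : Cn n f -> Cn n g -> Cn n (fun x => f x * g x).
Proof.
  revert f g; induction n as [|n IH]; intros f g Hf Hg; [exact I|].
  assert (Hf0 := Cn_le (S n) n f ltac:(lia) Hf).
  assert (Hg0 := Cn_le (S n) n g ltac:(lia) Hg).
  destruct Hf as [f' [Hf Hf']]; destruct Hg as [g' [Hg Hg']].
  exists (fun x => f' x * g x + f x * g' x); split.
  - intros x. apply (is_derive_mult f g x); auto. intros; apply Rmult_comm.
  - apply Cn_plus; apply IH; auto.
Qed.

Lemma Cn_scal n c f : Cn n f -> Cn n (fun x => c * f x).
Proof. intros; apply Cn_mult; auto using Cn_const. Qed.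

Lemma Cn_comp_affine n f a b : Cn n f -> Cn n (fun x => f (a * x + b)).
Proof.
  revert f; induction n as [|n IH]; intros f; simpl; auto.
  intros [f' [Hf Hf']]. exists (fun x => a * f' (a * x + b)); split.
  - intros x. apply (is_derive_comp f (fun x => a * x + b)); auto.
    auto_derive; auto; ring.
  - apply Cn_scal; auto.
Qed.

Lemma Cn_inv n f : (forall x, f x <> 0) -> Cn n f -> Cn n (fun x => / f x).
Proof.
  intros H0; induction n as [|n IH]; intros Hf; [exact I|].
  assert (Hf0 := Cn_le (S n) n f ltac:(lia) Hf).
  destruct Hf as [f' [Hf Hf']].
  exists (fun x => - (1) * f' x * (/ f x * / f x)); split.
  - intros x. evar_last; [apply (is_derive_inv f x); auto|]. field; auto.
  - repeat apply Cn_mult; auto using Cn_const.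
Qed.

Lemma Cn_exp_opp n : Cn n (fun x => exp (- x)).
Proof.
  induction n as [|n IH]; simpl; auto.
  exists (fun x => - (1) * exp (- x)); split; [|apply Cn_scal; auto].
  intros x; auto_derive; auto; ring.
Qed.

Definition flat (m : nat) (t : R) : R :=
  if Rlt_dec 0 t then (/ t) ^ m * exp (- / t) else 0.

Lemma flat_pos m t : 0 < t -> flat m t = (/ t) ^ m * exp (- / t).
Proof. intros; unfold flat; destruct (Rlt_dec 0 t); auto; lra. Qed.

Lemma flat_neg m t : t <= 0 -> flat m t = 0.
Proof. intros; unfold flat; destruct (Rlt_dec 0 t); auto; lra. Qed.

Lemma flat_gt0 m t : 0 < t -> 0 < flat m t.
Proof.
  intros; rewrite flat_pos; auto. apply Rmult_lt_0_compat; [|apply exp_pos].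
  apply pow_lt, Rinv_0_lt_compat; auto.
Qed.

Lemma flat_ge0 m t : 0 <= flat m t.
Proof.
  destruct (Rlt_dec 0 t); [apply Rlt_le, flat_gt0; auto|rewrite flat_neg; lra].
Qed.

Lemma exp_pow_INR k x : exp (INR k * x) = exp x ^ k.
Proof.
  induction k; [simpl; rewrite Rmult_0_l; apply exp_0|].
  rewrite S_INR, Rmult_plus_distr_r, exp_plus, IHk, Rmult_1_l. simpl; ring.
Qed.

Lemma flat_quadratic m t : 0 <= flat m t <= INR (S (S m)) ^ S (S m) * t ^ 2.
Proof.
  split; [apply flat_ge0|].
  assert (Hk : 0 < INR (S (S m))) by (apply lt_0_INR; lia).
  destruct (Rlt_dec 0 t) as [Ht|Ht].
  2:{ rewrite flat_neg by lra. apply Rmult_le_pos; [apply pow_le; lra|nra]. }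
  rewrite flat_pos by auto.
  set (k := S (S m)) in *.
  assert (Hs : 0 < / t) by (apply Rinv_0_lt_compat; auto).
  assert (H : (/ t) ^ k <= INR k ^ k * exp (/ t)).
  { replace (exp (/ t)) with (exp (/ t / INR k) ^ k).
    2:{ rewrite <- exp_pow_INR; f_equal; field; lra. }
    rewrite <- Rpow_mult_distr. apply pow_incr; split; [lra|].
    assert (H := exp_ineq1_le (/ t / INR k)).
    apply Rle_trans with (INR k * (/ t / INR k)); [right; field; lra|].
    apply Rmult_le_compat_l; lra. }
  rewrite exp_Ropp.
  assert (He := exp_pos (/ t)).
  apply Rmult_le_reg_r with (exp (/ t)); auto.
  rewrite Rmult_assoc, Rinv_l, Rmult_1_r by lra.
  apply Rmult_le_reg_r with ((/ t) ^ 2); [apply pow_lt; auto|].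
  rewrite <- pow_add. replace (m + 2)%nat with k by (unfold k; lia).
  eapply Rle_trans; [exact H|]. right. field; lra.
Qed.

Lemma is_derive_of_quadratic (f : R -> R) (x l C : R) :
  (forall y, Rabs (f y - f x - (y - x) * l) <= C * (y - x) ^ 2) -> is_derive f x l.
Proof.
  intros H. apply is_derive_Reals. intros e He.
  assert (HC : 0 < Rabs C + 1) by (assert (A := Rabs_pos C); lra).
  exists (mkposreal (e / (Rabs C + 1)) (Rdiv_lt_0_compat _ _ He HC)).
  intros h Hh Hlt; simpl in Hlt.
  assert (Hp : 0 < Rabs h) by (apply Rabs_pos_lt; auto).
  replace ((f (x + h) - f x) / h - l) with ((f (x + h) - f x - (x + h - x) * l) / h)
    by (field; auto).
  unfold Rdiv; rewrite Rabs_mult, Rabs_inv.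
  apply Rmult_lt_reg_r with (Rabs h); auto.
  rewrite Rmult_assoc, Rinv_l, Rmult_1_r by lra.
  eapply Rle_lt_trans; [apply H|].
  replace ((x + h - x) ^ 2) with (Rabs h * Rabs h)
    by (replace (x + h - x) with h by ring; rewrite <- pow2_abs; ring).
  apply Rle_lt_trans with (Rabs C * (Rabs h * Rabs h)).
  { apply Rmult_le_compat_r; [nra|apply Rle_abs]. }
  apply Rmult_lt_compat_r with (r := Rabs C + 1) in Hlt; auto.
  unfold Rdiv in Hlt; rewrite Rmult_assoc, Rinv_l, Rmult_1_r in Hlt by lra.
  nra.
Qed.

Lemma is_derive_flat m t :
  is_derive (flat m) t (flat (S (S m)) t + - INR m * flat (S m) t).
Proof.
  destruct (Rtotal_order t 0) as [Ht|[->|Ht]].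
  - apply is_derive_ext_loc with (fun _ => 0).
    + exists (mkposreal (- t) ltac:(lra)). intros y Hy.
      apply Rabs_lt_between' in Hy; simpl in Hy. rewrite flat_neg; lra.
    + rewrite !flat_neg by lra. evar_last; [apply is_derive_const|].
      unfold zero; simpl; ring.
  - rewrite !flat_neg by lra. rewrite Rmult_0_r, Rplus_0_r.
    apply is_derive_of_quadratic with (INR (S (S m)) ^ S (S m)). intros s.
    rewrite (flat_neg m 0), Rmult_0_r, !Rminus_0_r by lra.
    destruct (flat_quadratic m s). rewrite Rabs_pos_eq; auto.
  - apply is_derive_ext_loc with (fun t => (/ t) ^ m * exp (- / t)).
    + exists (mkposreal t Ht). intros y Hy.
      apply Rabs_lt_between' in Hy; simpl in Hy. rewrite flat_pos; auto; lra.
    + rewrite !flat_pos by auto. destruct m as [|m].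
      * auto_derive; [lra|]. simpl. field; lra.
      * auto_derive; [lra|]. change (Init.Nat.pred (S m)) with m.
        change (match m with O => 1 | S _ => INR m + 1 end) with (INR (S m)).
        rewrite !S_INR. generalize (INR m); intros k. simpl. field; lra.
Qed.

Lemma Cn_flat n m : Cn n (flat m).
Proof.
  revert m; induction n as [|n IH]; intros m; [exact I|].
  eexists; split; [intros x; apply is_derive_flat|].
  apply Cn_plus; [|apply Cn_scal]; apply IH.
Qed.

Definition smooth1 (f : R -> R) := forall n, Cn n f.

Lemma Cn_continuous n f (x : R) : Cn (S n) f -> continuous f x.
Proof. intros [f' [H _]]. apply (ex_derive_continuous f x); eexists; apply H. Qed.

Fixpoint Bn (n : nat) (f : R -> R) : Prop :=
  (exists M, forall x, Rabs (f x) <= M) /\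
  match n with
  | O => True
  | S m => exists f' : R -> R, (forall x : R, is_derive f x (f' x)) /\ Bn m f'
  end.

Definition bsmooth (f : R -> R) := forall n, Bn n f.

Lemma bounded_on_segment f a b : a <= b -> (forall x, continuous f x) ->
  exists M, forall x, a <= x <= b -> Rabs (f x) <= M.
Proof.
  intros Hab Hf.
  destruct (continuity_ab_maj (fun x => Rabs (f x)) a b Hab) as [m [Hm _]].
  { intros c _. apply continuity_pt_filterlim.
    apply (continuous_comp f Rabs); [apply Hf|apply continuous_Rabs]. }
  exists (Rabs (f m)); auto.
Qed.

(* The exponential tail serves [expcut] below; [c = 0] is the compactly supported case. *)
Lemma Bn_of_tails n f a b c : a <= b -> 0 <= b -> Cn (S n) f ->
  (forall x, x < a -> f x = 0) -> (forall x, b < x -> f x = c * exp (- x)) -> Bn n f.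
Proof.
  intros Hab Hb; revert f c; induction n as [|n IH]; intros f c Hf Ha Hc.
  all: split; auto.
  1,2: destruct (bounded_on_segment f a b Hab) as [M HM];
    [intros x; eapply Cn_continuous; exact Hf|].
  1,2: exists (Rmax M (Rabs c)); intros x; destruct (Rlt_dec x a) as [H1|H1];
    [rewrite Ha, Rabs_R0 by auto; eapply Rle_trans; [apply Rabs_pos|apply Rmax_r]|];
    destruct (Rlt_dec b x) as [H2|H2];
    [|eapply Rle_trans; [apply HM; lra|apply Rmax_l]];
    rewrite Hc by auto; eapply Rle_trans; [|apply Rmax_r];
    rewrite Rabs_mult, (Rabs_pos_eq (exp (- x))) by (apply Rlt_le, exp_pos);
    assert (exp (- x) <= 1) by (rewrite <- exp_0; apply Rlt_le, exp_increasing; lra);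
    assert (0 <= Rabs c) by apply Rabs_pos; nra.
  destruct Hf as [f' [Hd Hf']]. exists f'; split; auto.
  apply IH with (- c); auto.
  - intros x Hx. rewrite <- (is_derive_unique _ _ _ (Hd x)).
    rewrite (Derive_ext_loc f (fun _ => 0)); [apply Derive_const|].
    exists (mkposreal (a - x) ltac:(lra)). intros y Hy.
    apply Rabs_lt_between' in Hy; simpl in Hy. apply Ha; lra.
  - intros x Hx. rewrite <- (is_derive_unique _ _ _ (Hd x)).
    rewrite (Derive_ext_loc f (fun t => c * exp (- t))).
    + apply is_derive_unique. auto_derive; auto; ring.
    + exists (mkposreal (x - b) ltac:(lra)). intros y Hy.
      apply Rabs_lt_between' in Hy; simpl in Hy. apply Hc; lra.
Qed.

Definition expcut (t : R) : R :=
  exp (- t) * (flat 0 (1 * t + 1) * / (flat 0 (1 * t + 1) + flat 0 ((-1) * t + 0))).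

Lemma expcut_right t : 0 <= t -> expcut t = exp (- t).
Proof.
  intros; unfold expcut. rewrite (flat_neg 0 (-1 * t + 0)) by lra.
  assert (0 < flat 0 (1 * t + 1)) by (apply flat_gt0; lra). field; lra.
Qed.

Lemma expcut_left t : t < -1 -> expcut t = 0.
Proof. intros; unfold expcut. rewrite (flat_neg 0 (1 * t + 1)) by lra. ring. Qed.

Lemma bsmooth_expcut : bsmooth expcut.
Proof.
  intros n. apply Bn_of_tails with (-1) 0 1; try lra.
  - unfold expcut. apply Cn_mult; [apply Cn_exp_opp|].
    apply Cn_mult; [apply Cn_comp_affine, Cn_flat|]. apply Cn_inv.
    + intros x. assert (H1 := flat_ge0 0 (1 * x + 1)).
      assert (H2 := flat_ge0 0 (-1 * x + 0)).
      destruct (Rlt_dec x 0).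
      * assert (0 < flat 0 (-1 * x + 0)) by (apply flat_gt0; lra). lra.
      * assert (0 < flat 0 (1 * x + 1)) by (apply flat_gt0; lra). lra.
    + apply Cn_plus; apply Cn_comp_affine, Cn_flat.
  - apply expcut_left.
  - intros x Hx; rewrite expcut_right; lra.
Qed.

Lemma Bn_scal n c f : Bn n f -> Bn n (fun x => c * f x).
Proof.
  revert f; induction n as [|n IH]; intros f [[M HM] H]; split; auto.
  1,2: exists (Rabs c * M); intros x; rewrite Rabs_mult;
    apply Rmult_le_compat_l; auto; apply Rabs_pos.
  destruct H as [f' [H1 H2]]. exists (fun x => c * f' x); split; auto.
  intros x; apply (is_derive_scal f x c); auto.
Qed.

Lemma Bn_cos_sin n : Bn n cos /\ Bn n sin.
Proof.
  assert (Bc : exists M, forall x, Rabs (cos x) <= M)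
    by (exists 1; intros x; apply Rabs_le; apply COS_bound).
  assert (Bs : exists M, forall x, Rabs (sin x) <= M)
    by (exists 1; intros x; apply Rabs_le; apply SIN_bound).
  induction n as [|n [IHc IHs]]; [split; split; auto|].
  split; split; auto.
  - exists (fun x => -1 * sin x); split; [|apply Bn_scal; auto].
    intros x; auto_derive; auto; ring.
  - exists cos; split; auto. intros x; auto_derive; auto; ring.
Qed.

Lemma bsmooth_derive f : bsmooth f ->
  exists f' : R -> R, (forall x : R, is_derive f x (f' x)) /\ bsmooth f'.
Proof.
  intros H. destruct (H 1%nat) as [_ [f' [Hd _]]]. exists f'; split; auto.
  intros n. destruct (H (S n)) as [_ [f'' [Hd' Hn]]].
  replace f' with f''; auto. apply functional_extensionality; intros x.
  rewrite <- (is_derive_unique _ _ _ (Hd x)). symmetry; apply is_derive_unique; auto.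
Qed.

Lemma smooth1_derive f : smooth1 f ->
  exists f' : R -> R, (forall x : R, is_derive f x (f' x)) /\ smooth1 f'.
Proof.
  intros H. destruct (H 1%nat) as [f' [Hd _]]. exists f'; split; auto.
  intros n. destruct (H (S n)) as [f'' [Hd' Hn]].
  replace f' with f''; auto. apply functional_extensionality; intros x.
  rewrite <- (is_derive_unique _ _ _ (Hd x)). symmetry; apply is_derive_unique; auto.
Qed.

(** * Smooth functions with prescribed zero set *)

Lemma lip_of_derive (f f' : R -> R) M : (forall x, is_derive f x (f' x)) ->
  (forall x, Rabs (f' x) <= M) -> forall x y, Rabs (f y - f x) <= M * Rabs (y - x).
Proof.
  intros Hd HM x y.
  destruct (MVT_gen f x y f') as [c [_ ->]].
  - intros; apply Hd.
  - intros z _. apply continuity_pt_filterlim, (ex_derive_continuous f z).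
    eexists; apply Hd.
  - rewrite Rabs_mult. apply Rmult_le_compat_r; auto using Rabs_pos.
Qed.

Lemma taylor_of_lip (f f' : R -> R) M : (forall x, is_derive f x (f' x)) ->
  (forall x y, Rabs (f' y - f' x) <= M * Rabs (y - x)) ->
  forall x y, Rabs (f y - f x - (y - x) * f' x) <= M * (y - x) ^ 2.
Proof.
  intros Hd HM x y.
  assert (M0 : 0 <= M).
  { assert (H := HM 0 1). rewrite Rminus_0_r, Rabs_R1 in H.
    assert (H' := Rabs_pos (f' 1 - f' 0)). lra. }
  destruct (MVT_gen f x y f') as [c [Hc ->]].
  - intros; apply Hd.
  - intros z _. apply continuity_pt_filterlim, (ex_derive_continuous f z).
    eexists; apply Hd.
  - replace (f' c * (y - x) - (y - x) * f' x) with ((f' c - f' x) * (y - x)) by ring.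
    rewrite Rabs_mult, <- pow2_abs. simpl; rewrite Rmult_1_r, <- Rmult_assoc.
    apply Rmult_le_compat_r; auto using Rabs_pos.
    eapply Rle_trans; [apply HM|]. apply Rmult_le_compat_l; auto.
    unfold Rmin, Rmax in Hc. destruct (Rle_dec x y); unfold Rabs;
      destruct (Rcase_abs (c - x)), (Rcase_abs (y - x)); lra.
Qed.

Lemma Series_abs_le (a b : nat -> R) : (forall k, Rabs (a k) <= b k) -> ex_series b ->
  ex_series a /\ Rabs (Series a) <= Series b.
Proof.
  intros H Hb.
  assert (Ha : ex_series (fun k => Rabs (a k)))
    by (apply (ex_series_le (fun k => Rabs (a k)) b); auto;
        intros k; unfold norm; simpl; unfold abs; simpl; rewrite Rabs_Rabsolu; auto).
  split; [apply ex_series_Rabs; auto|].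
  eapply Rle_trans; [apply Series_Rabs; auto|].
  apply Series_le; auto. intros k; split; auto using Rabs_pos.
Qed.

Lemma is_derive_Series (f f' f'' : nat -> R -> R) (A A' A'' : nat -> R) :
  (forall k x, is_derive (f k) x (f' k x)) ->
  (forall k x, is_derive (f' k) x (f'' k x)) ->
  (forall k x, Rabs (f k x) <= A k) -> (forall k x, Rabs (f' k x) <= A' k) ->
  (forall k x, Rabs (f'' k x) <= A'' k) ->
  ex_series A -> ex_series A' -> ex_series A'' ->
  forall x, is_derive (fun x => Series (fun k => f k x)) x (Series (fun k => f' k x)).
Proof.
  intros D D' B B' B'' S S' S'' x.
  apply is_derive_of_quadratic with (Series A''). intros y.
  assert (E : forall z, ex_series (fun k => f k z))
    by (intros z; apply (proj1 (Series_abs_le _ _ (fun k => B k z) S))).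
  assert (E' : ex_series (fun k => f' k x))
    by apply (proj1 (Series_abs_le _ _ (fun k => B' k x) S')).
  rewrite <- Series_minus, <- Series_scal_l, <- Series_minus, <- Series_scal_r; auto.
  2: apply (ex_series_minus (fun k => f k y) (fun k => f k x)); auto.
  2: apply (ex_series_scal (y - x) (fun k => f' k x)); auto.
  apply Series_abs_le.
  - intros k. apply (taylor_of_lip (f k) (f' k)); auto.
    intros; apply (lip_of_derive (f' k) (f'' k)); auto.
  - apply (ex_series_scal_r ((y - x) ^ 2) A''); auto.
Qed.

Lemma bsmooth_Derive_n f j : bsmooth f ->
  bsmooth (Derive_n f j) /\ (forall x, is_derive (Derive_n f j) x (Derive_n f (S j) x)).
Proof.
  assert (H : forall g, bsmooth g ->
    bsmooth (Derive g) /\ forall x, is_derive g x (Derive g x)).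
  { intros g Hg. destruct (bsmooth_derive g Hg) as [g' [Hd Hb]].
    replace (Derive g) with g'; auto.
    apply functional_extensionality; intros x; symmetry; apply is_derive_unique; auto. }
  intros Hf. induction j as [|j [IH1 IH2]]; [split; auto; apply H; auto|].
  change (Derive_n f (S j)) with (Derive (Derive_n f j)).
  destruct (H _ IH1) as [H1 _]. split; auto. apply H; auto.
Qed.

Lemma ex_series_half : ex_series (fun k => (1 / 2) ^ k).
Proof.
  apply (ex_series_geom (1 / 2)). rewrite Rabs_pos_eq; lra.
Qed.

Lemma weighted_sum_smooth (b : nat -> R -> R) :
  (forall k, bsmooth (b k)) -> (forall k x, 0 <= b k x) ->
  exists psi, smooth1 psi /\ (forall x, 0 <= psi x) /\
    forall x, psi x = 0 <-> forall k, b k x = 0.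
Proof.
  intros Hb Hpos.
  assert (HM : forall k j, exists M, forall x, Rabs (Derive_n (b k) j x) <= M).
  { intros k j. apply (proj1 (bsmooth_Derive_n (b k) j (Hb k)) 0%nat). }
  assert (HB : forall k n, exists B, 0 < B /\
    forall j x, (j <= n)%nat -> Rabs (Derive_n (b k) j x) <= B).
  { intros k n. induction n as [|n [B [B0 IH]]].
    - destruct (HM k 0%nat) as [M Mx]. exists (Rmax M 1); split.
      + assert (H := Rmax_r M 1); lra.
      + intros j x Hj. replace j with 0%nat by lia.
        eapply Rle_trans; [apply Mx|apply Rmax_l].
    - destruct (HM k (S n)) as [M Mx]. exists (Rmax M B); split.
      + assert (H := Rmax_r M B); lra.
      + intros j x Hj. destruct (PeanoNat.Nat.eq_dec j (S n)) as [->|Hn].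
        * eapply Rle_trans; [apply Mx|apply Rmax_l].
        * eapply Rle_trans; [apply IH; lia|apply Rmax_r]. }
  assert (HB' : exists B : nat -> R, forall k, 0 < B k /\
    forall j x, (j <= k)%nat -> Rabs (Derive_n (b k) j x) <= B k).
  { exists (fun k => proj1_sig (constructive_indefinite_description _ (HB k k))).
    intros k. exact (proj2_sig (constructive_indefinite_description _ (HB k k))). }
  destruct HB' as [B HB'].
  assert (HM' : exists M : nat -> nat -> R, forall k j x, Rabs (Derive_n (b k) j x) <= M k j).
  { exists (fun k j => proj1_sig (constructive_indefinite_description _ (HM k j))).
    intros k j. exact (proj2_sig (constructive_indefinite_description _ (HM k j))). }
  destruct HM' as [M HM'].
  set (e := fun k => (1 / 2) ^ k / B k).
  assert (He : forall k, 0 < e k).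
  { intros k. apply Rdiv_lt_0_compat; [apply pow_lt; lra|apply HB']. }
  set (A := fun j k => if Compare_dec.le_lt_dec j k then (1 / 2) ^ k else e k * M k j).
  assert (HA : forall j k x, Rabs (e k * Derive_n (b k) j x) <= A j k).
  { intros j k x. rewrite Rabs_mult, (Rabs_pos_eq (e k)) by (apply Rlt_le, He).
    unfold A; destruct (Compare_dec.le_lt_dec j k) as [H|H].
    - destruct (HB' k) as [H0 H1]. apply Rle_trans with (e k * B k).
      + apply Rmult_le_compat_l; [apply Rlt_le, He|auto].
      + right; unfold e; field; lra.
    - apply Rmult_le_compat_l; [apply Rlt_le, He|auto]. }
  assert (SA : forall j, ex_series (A j)).
  { intros j. apply (ex_series_incr_n (A j) j).
    apply ex_series_ext with (fun k => (1 / 2) ^ (j + k)).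
    - intros k. unfold A. destruct (Compare_dec.le_lt_dec j (j + k)); auto; lia.
    - apply (ex_series_incr_n (fun k => (1 / 2) ^ k) j), ex_series_half. }
  set (F := fun j x => Series (fun k => e k * Derive_n (b k) j x)).
  assert (HF : forall j x, is_derive (F j) x (F (S j) x)).
  { intros j x. unfold F.
    apply (is_derive_Series (fun k x => e k * Derive_n (b k) j x)
      (fun k x => e k * Derive_n (b k) (S j) x)
      (fun k x => e k * Derive_n (b k) (S (S j)) x) (A j) (A (S j)) (A (S (S j)))); auto.
    all: intros k z; apply (is_derive_scal (Derive_n (b k) _) z (e k));
      apply bsmooth_Derive_n; auto. }
  assert (SF : forall n j, Cn n (F j)).
  { induction n as [|n IH]; intros j; [exact I|]. exists (F (S j)); split; auto. }
  exists (F 0%nat); split; [intros n; apply SF|].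
  assert (T0 : forall x k, 0 <= e k * Derive_n (b k) 0 x).
  { intros x k; apply Rmult_le_pos; [apply Rlt_le, He|apply Hpos]. }
  assert (S0 : forall x, ex_series (fun k => e k * Derive_n (b k) 0 x)).
  { intros x; apply (proj1 (Series_abs_le _ _ (fun k => HA 0%nat k x) (SA 0%nat))). }
  assert (G : forall x k, e k * b k x <= F 0%nat x).
  { intros x k. unfold F.
    rewrite (Series_incr_n _ (S k)); [|lia|auto].
    assert (H1 : 0 <= Series (fun i => e (S k + i)%nat * Derive_n (b (S k + i)%nat) 0 x)).
    { rewrite <- (Rmult_0_l (Series (fun _ => 0))), <- Series_scal_l.
      apply Series_le; [intros i; split; [lra|rewrite Rmult_0_l; apply T0]|].
      apply (ex_series_incr_n (fun i => e i * Derive_n (b i) 0 x) (S k)); auto. }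
    assert (H2 : e k * b k x <= sum_f_R0 (fun i => e i * Derive_n (b i) 0 x) (Init.Nat.pred (S k))).
    { simpl. destruct k; simpl; [lra|].
      assert (H := cond_pos_sum (fun i => e i * b i x) k (T0 x)). lra. }
    lra. }
  split.
  - intros x. eapply Rle_trans; [apply (T0 x 0%nat)|apply G].
  - intros x; split; intros H.
    + intros k. assert (H1 := G x k). rewrite H in H1.
      assert (H2 := Hpos k x). assert (H3 := He k).
      destruct (Rle_lt_or_eq_dec _ _ H2) as [H4|H4]; auto.
      assert (0 < e k * b k x) by (apply Rmult_lt_0_compat; auto). lra.
    + unfold F. rewrite (Series_ext _ (fun _ => 0 * 0)).
      * rewrite Series_scal_l; ring.
      * intros k. simpl. rewrite H; ring.
Qed.

Lemma closed_set_smooth_function (Z : R -> Prop) : closed1 Z ->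
  (forall x, x <= 0 -> Z x) ->
  exists psi, smooth1 psi /\ (forall x, 0 <= psi x) /\ forall x, psi x = 0 <-> Z x.
Proof.
  intros HZ HZ0.
  set (c := fun k => INR (fst (of_nat k)) / (INR (snd (of_nat k)) + 1)).
  set (r := fun k => / (INR (snd (of_nat k)) + 1)).
  set (P := fun k => forall y, Rabs (y - c k) < r k -> ~ Z y).
  set (b := fun k x => if excluded_middle_informative (P k)
    then flat 0 (1 * x + (r k - c k)) * flat 0 (-1 * x + (r k + c k)) else 0).
  assert (Hr : forall k, 0 < r k).
  { intros k; unfold r. apply Rinv_0_lt_compat.
    assert (H := pos_INR (snd (of_nat k))); lra. }
  assert (Hc : forall k, 0 <= c k).
  { intros k; unfold c. apply Rmult_le_pos; [apply pos_INR|apply Rlt_le, Hr]. }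
  destruct (weighted_sum_smooth b) as [psi [H1 [H2 H3]]].
  - intros k n. specialize (Hr k); specialize (Hc k). unfold b.
    destruct (excluded_middle_informative (P k));
      apply Bn_of_tails with (c k - r k) (c k + r k) 0; auto; try lra.
    + apply Cn_mult; apply Cn_comp_affine, Cn_flat.
    + intros x Hx. rewrite (flat_neg 0 (1 * x + (r k - c k))) by lra. ring.
    + intros x Hx. rewrite (flat_neg 0 (-1 * x + (r k + c k))) by lra. ring.
    + apply Cn_const.
    + intros; ring.
  - intros k x; unfold b. destruct (excluded_middle_informative (P k)); [|lra].
    apply Rmult_le_pos; apply flat_ge0.
  - exists psi; split; [|split]; auto. intros x. rewrite H3. split; intros H.
    + apply HZ. intros e He. apply Classical_Prop.NNPP; intros Hno.
      assert (Hx : 0 < x).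
      { apply Rnot_le_lt; intros Hx. apply Hno. exists x; split; auto.
        rewrite Rminus_diag, Rabs_R0; auto. }
      destruct (nfloor_ex (2 / e)) as [j [_ Hj]]; [apply Rlt_le, Rdiv_lt_0_compat; lra|].
      assert (Hj0 := pos_INR j).
      destruct (nfloor_ex (x * (INR j + 1))) as [i [Hi1 Hi2]]; [nra|].
      set (k := to_nat (i, j)).
      assert (Ek : of_nat k = (i, j)) by apply cancel_of_to.
      assert (Hre : r k < e / 2).
      { unfold r. rewrite Ek. simpl snd.
        replace (e / 2) with (/ (2 / e)) by (field; lra).
        apply Rinv_lt_contravar; [|lra]. apply Rmult_lt_0_compat; [|lra].
        apply Rdiv_lt_0_compat; lra. }
      assert (Hxc : Rabs (x - c k) < r k).
      { assert (E : x - c k = (x * (INR j + 1) - INR i) * r k)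
          by (unfold c, r; rewrite Ek; simpl; field; lra).
        rewrite E, Rabs_mult, (Rabs_pos_eq (r k)) by (apply Rlt_le, Hr).
        rewrite <- (Rmult_1_l (r k)) at 2. apply Rmult_lt_compat_r; [apply Hr|].
        rewrite Rabs_pos_eq; lra. }
      assert (Pk : P k).
      { intros y Hy Zy. apply Hno. exists y; split; auto.
        replace (x - y) with ((x - c k) - (y - c k)) by ring.
        eapply Rle_lt_trans; [apply Rabs_triang|]. rewrite Rabs_Ropp. lra. }
      specialize (H k). unfold b in H.
      destruct (excluded_middle_informative (P k)) as [_|]; [|tauto].
      apply Rabs_lt_between in Hxc.
      assert (0 < flat 0 (1 * x + (r k - c k))) by (apply flat_gt0; lra).
      assert (0 < flat 0 (-1 * x + (r k + c k))) by (apply flat_gt0; lra).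
      assert (0 < flat 0 (1 * x + (r k - c k)) * flat 0 (-1 * x + (r k + c k)))
        by (apply Rmult_lt_0_compat; auto). lra.
    + intros k; unfold b. destruct (excluded_middle_informative (P k)) as [p|]; auto.
      destruct (Rle_dec (1 * x + (r k - c k)) 0) as [L|L];
        [rewrite (flat_neg 0 _ L); ring|].
      destruct (Rle_dec (-1 * x + (r k + c k)) 0) as [L'|L'];
        [rewrite (flat_neg 0 _ L'); ring|].
      exfalso. apply (p x); auto. apply Rabs_lt_between; lra.
Qed.

(** * Cosine series *)

Definition conPI (f : R -> R) := forall t, 0 <= t <= PI -> continuous f t.
Definition IPI (f : R -> R) : R := RInt f 0 PI.

Lemma PI_gt3 : 3 < PI.
Proof. assert (H := PI2_3_2). lra. Qed.

Lemma conPI_ex f : conPI f -> ex_RInt f 0 PI.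
Proof.
  intros H. apply (ex_RInt_continuous f). intros t Ht. apply H.
  rewrite Rmin_left, Rmax_right in Ht by (assert (P := PI_gt3); lra). auto.
Qed.

Lemma conPI_plus f g : conPI f -> conPI g -> conPI (fun t => f t + g t).
Proof. intros Hf Hg t Ht. apply (continuous_plus f g); auto. Qed.

Lemma conPI_mult f g : conPI f -> conPI g -> conPI (fun t => f t * g t).
Proof. intros Hf Hg t Ht. apply (continuous_mult f g); auto. Qed.

Lemma conPI_const c : conPI (fun _ => c).
Proof. intros t _. apply continuous_const. Qed.

Lemma conPI_cos k : conPI (fun t => cos (k * t)).
Proof.
  intros t _. apply (ex_derive_continuous (fun t => cos (k * t))). auto_derive; auto.
Qed.

Lemma conPI_sin k : conPI (fun t => sin (k * t)).
Proof.
  intros t _. apply (ex_derive_continuous (fun t => sin (k * t))). auto_derive; auto.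
Qed.

Lemma conPI_smooth f : smooth1 f -> conPI f.
Proof. intros H t _. apply (Cn_continuous 0 f t), H. Qed.

#[local] Hint Resolve conPI_plus conPI_mult conPI_const conPI_cos conPI_sin conPI_smooth : con.

Lemma IPI_plus f g : conPI f -> conPI g -> IPI (fun t => f t + g t) = IPI f + IPI g.
Proof. intros; apply (RInt_plus f g); apply conPI_ex; auto. Qed.

Lemma IPI_scal c f : conPI f -> IPI (fun t => c * f t) = c * IPI f.
Proof. intros; apply (RInt_scal f); apply conPI_ex; auto. Qed.

Lemma IPI_ext f g : (forall t, 0 <= t <= PI -> f t = g t) -> IPI f = IPI g.
Proof.
  intros H. apply RInt_ext. intros t Ht. apply H.
  rewrite Rmin_left, Rmax_right in Ht by (assert (P := PI_gt3); lra). lra.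
Qed.

Lemma IPI_derive (F f : R -> R) : (forall t : R, is_derive F t (f t)) -> conPI f ->
  IPI f = F PI - F 0.
Proof.
  intros H Hf. apply is_RInt_unique. apply (is_RInt_derive F f).
  - intros; apply H.
  - intros t Ht. apply Hf.
    rewrite Rmin_left, Rmax_right in Ht by (assert (P := PI_gt3); lra). auto.
Qed.

Lemma cosine_coeff_decay m f : smooth1 f -> (forall x, x < / 4 -> f x = 0) ->
  (forall x, 3 < x -> f x = 0) ->
  exists C, forall n, INR n ^ m * Rabs (IPI (fun t => f t * cos (INR n * t))) <= C /\
    INR n ^ m * Rabs (IPI (fun t => f t * sin (INR n * t))) <= C.
Proof.
  assert (P := PI_gt3).
  revert f; induction m as [|m IH]; intros f Hf H0 H3.
  - destruct (bounded_on_segment f 0 PI) as [M HM]; [lra| |].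
    { intros x; apply (Cn_continuous 0 f x), Hf. }
    exists ((PI - 0) * M). intros n. simpl (INR n ^ 0). rewrite !Rmult_1_l.
    split; (apply abs_RInt_le_const; [lra|apply conPI_ex; auto with con|]);
      intros t Ht; rewrite Rabs_mult; specialize (HM t Ht);
      assert (A := Rabs_pos (f t)).
    + assert (Rabs (cos (INR n * t)) <= 1) by (apply Rabs_le, COS_bound).
      assert (B := Rabs_pos (cos (INR n * t))). nra.
    + assert (Rabs (sin (INR n * t)) <= 1) by (apply Rabs_le, SIN_bound).
      assert (B := Rabs_pos (sin (INR n * t))). nra.
  - destruct (smooth1_derive f Hf) as [f' [Hd Hf']].
    destruct (IH f' Hf') as [C HC].
    { intros x Hx. rewrite <- (is_derive_unique _ _ _ (Hd x)).
      rewrite (Derive_ext_loc f (fun _ => 0)); [apply Derive_const|].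
      exists (mkposreal (/ 4 - x) ltac:(lra)). intros y Hy.
      apply Rabs_lt_between' in Hy; simpl in Hy. apply H0; lra. }
    { intros x Hx. rewrite <- (is_derive_unique _ _ _ (Hd x)).
      rewrite (Derive_ext_loc f (fun _ => 0)); [apply Derive_const|].
      exists (mkposreal (x - 3) ltac:(lra)). intros y Hy.
      apply Rabs_lt_between' in Hy; simpl in Hy. apply H3; lra. }
    assert (F0 : f 0 = 0) by (apply H0; lra).
    assert (FP : f PI = 0) by (apply H3; lra).
    exists C. intros n. destruct (HC n) as [Hc Hs].
    assert (E1 : IPI (fun t => f' t * sin (INR n * t)) =
      - (INR n * IPI (fun t => f t * cos (INR n * t)))).
    { assert (E : IPI (fun t => f' t * sin (INR n * t) + INR n * (f t * cos (INR n * t)))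
        = 0).
      { rewrite (IPI_derive (fun t => f t * sin (INR n * t))); auto 6 with con.
        - rewrite F0, FP; ring.
        - intros t. evar_last.
          + apply (is_derive_mult f (fun t => sin (INR n * t)) t); [apply Hd| |].
            * auto_derive; auto.
            * intros; apply Rmult_comm.
          + unfold plus, mult; simpl; ring. }
      rewrite IPI_plus, IPI_scal in E; auto 6 with con. lra. }
    assert (E2 : IPI (fun t => f' t * cos (INR n * t)) =
      INR n * IPI (fun t => f t * sin (INR n * t))).
    { assert (E : IPI (fun t => f' t * cos (INR n * t) +
          (- INR n) * (f t * sin (INR n * t))) = 0).
      { rewrite (IPI_derive (fun t => f t * cos (INR n * t))); auto 6 with con.
        - rewrite F0, FP; ring.
        - intros t. evar_last.
          + apply (is_derive_mult f (fun t => cos (INR n * t)) t); [apply Hd| |].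
            * auto_derive; auto.
            * intros; apply Rmult_comm.
          + unfold plus, mult; simpl; ring. }
      rewrite IPI_plus, IPI_scal in E; auto 6 with con. lra. }
    assert (N := pos_INR n).
    rewrite E1, Rabs_Ropp, Rabs_mult, (Rabs_pos_eq (INR n) N) in Hs.
    rewrite E2, Rabs_mult, (Rabs_pos_eq (INR n) N) in Hc.
    simpl; split; lra.
Qed.

Lemma IPI_cos_IZR z : (z <> 0)%Z -> IPI (fun t => cos (IZR z * t)) = 0.
Proof.
  intros Hz. assert (IZR z <> 0) by (apply not_0_IZR; auto).
  rewrite (IPI_derive (fun t => sin (IZR z * t) / IZR z)); auto with con.
  - rewrite Rmult_0_r, sin_0. rewrite (sin_eq_0_1 (IZR z * PI)) by (exists z; auto).
    field; auto.
  - intros t; auto_derive; auto. field; auto.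
Qed.

Lemma cos_mult_cos a b : cos a * cos b = / 2 * (cos (a + b) + cos (a - b)).
Proof. rewrite cos_plus, cos_minus; lra. Qed.

Lemma cos_orthogonal n m : (n < m)%nat ->
  IPI (fun t => cos (INR n * t) * cos (INR m * t)) = 0.
Proof.
  intros H.
  rewrite (IPI_ext _ (fun t => / 2 * (cos (IZR (Z.of_nat n + Z.of_nat m) * t) +
    cos (IZR (Z.of_nat n - Z.of_nat m) * t)))).
  - rewrite IPI_scal, IPI_plus, !IPI_cos_IZR; auto with con; try lia; ring.
  - intros t _. rewrite cos_mult_cos, plus_IZR, minus_IZR, <- !INR_IZR_INZ.
    do 2 f_equal; f_equal; ring.
Qed.

Lemma IPI_const c : IPI (fun _ => c) = PI * c.
Proof. unfold IPI; rewrite RInt_const. unfold scal; simpl; unfold mult; simpl; ring. Qed.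

Lemma cos_square_integral n :
  IPI (fun t => cos (INR (S n) * t) * cos (INR (S n) * t)) = PI / 2.
Proof.
  rewrite (IPI_ext _ (fun t => / 2 * (cos (IZR (2 * Z.of_nat (S n)) * t) + 1))).
  - rewrite IPI_scal, IPI_plus, IPI_cos_IZR, IPI_const; auto with con; [field|lia].
  - intros t _. rewrite cos_mult_cos, mult_IZR, <- INR_IZR_INZ.
    do 2 f_equal; [f_equal; ring|]. rewrite Rminus_diag; apply cos_0.
Qed.

(* Bessel's inequality: [bessel_rem f N] is [f] minus its projection on [cos t, ..., cos (N t)]. *)
Fixpoint bessel_rem (f : R -> R) (N : nat) (t : R) : R :=
  match N with
  | O => f t
  | S N' => bessel_rem f N' t +
      (- (2 / PI) * IPI (fun s => f s * cos (INR N * s))) * cos (INR N * t)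
  end.

Lemma conPI_bessel_rem f N : conPI f -> conPI (bessel_rem f N).
Proof.
  intros Hf; induction N as [|N IH]; [exact Hf|].
  apply conPI_plus; auto. apply conPI_mult; auto with con.
Qed.

Lemma bessel_rem_coeff f N m : conPI f -> (N < m)%nat ->
  IPI (fun t => bessel_rem f N t * cos (INR m * t)) = IPI (fun t => f t * cos (INR m * t)).
Proof.
  intros Hf; induction N as [|N IH]; intros H; [reflexivity|].
  cbn [bessel_rem]. set (d := - (2 / PI) * IPI (fun s => f s * cos (INR (S N) * s))).
  rewrite (IPI_ext _ (fun t => bessel_rem f N t * cos (INR m * t) +
    d * (cos (INR (S N) * t) * cos (INR m * t)))) by (intros; ring).
  assert (Hr := conPI_bessel_rem f N Hf).
  rewrite IPI_plus, IPI_scal, cos_orthogonal, IH; auto with con; try lia.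
  rewrite Rmult_0_r, Rplus_0_r; reflexivity.
Qed.

Lemma bessel_rem_step f N : conPI f ->
  IPI (fun t => bessel_rem f (S N) t * bessel_rem f (S N) t) =
  IPI (fun t => bessel_rem f N t * bessel_rem f N t) -
  2 / PI * IPI (fun t => f t * cos (INR (S N) * t)) ^ 2.
Proof.
  intros Hf. cbn [bessel_rem]. set (d := IPI (fun s => f s * cos (INR (S N) * s))).
  assert (Hr := conPI_bessel_rem f N Hf). assert (P := PI_gt3).
  rewrite (IPI_ext _ (fun t => bessel_rem f N t * bessel_rem f N t +
    ((2 * (- (2 / PI) * d)) * (bessel_rem f N t * cos (INR (S N) * t)) +
    (- (2 / PI) * d) ^ 2 * (cos (INR (S N) * t) * cos (INR (S N) * t))))) by (intros; ring).
  rewrite !IPI_plus, !IPI_scal, cos_square_integral, bessel_rem_coeff; auto 8 with con.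
  fold d. field; lra.
Qed.

Lemma riemann_lebesgue_cos f : conPI f ->
  is_lim_seq (fun n => IPI (fun t => f t * cos (INR n * t))) 0.
Proof.
  intros Hf. assert (P := PI_gt3).
  set (d := fun n => IPI (fun t => f t * cos (INR n * t))).
  set (Q := fun N => IPI (fun t => bessel_rem f N t * bessel_rem f N t)).
  assert (HQ : forall N, Q (S N) = Q N - 2 / PI * d (S N) ^ 2)
    by (intros N; apply bessel_rem_step; auto).
  assert (P2 : 0 < 2 / PI) by (apply Rdiv_lt_0_compat; lra).
  assert (Q0 : forall N, 0 <= Q N).
  { intros N. apply RInt_ge_0; [lra| |].
    - apply conPI_ex. apply conPI_mult; apply conPI_bessel_rem; auto.
    - intros t _. nra. }
  destruct (ex_finite_lim_seq_decr Q 0) as [l Hl]; auto.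
  { intros N. rewrite HQ. assert (A := pow2_ge_0 (d (S N))). nra. }
  apply (is_lim_seq_incr_1 d). apply is_lim_seq_abs_0.
  assert (L2 : is_lim_seq (fun n => d (S n) ^ 2) 0).
  { apply is_lim_seq_ext with (fun n => PI / 2 * (Q n - Q (S n))).
    - intros n. rewrite HQ. field; lra.
    - evar_last.
      + apply is_lim_seq_scal_l. apply is_lim_seq_minus'; [exact Hl|].
        apply -> is_lim_seq_incr_1; exact Hl.
      + simpl. f_equal; ring. }
  apply is_lim_seq_ext with (fun n => sqrt (d (S n) ^ 2)).
  - intros n. rewrite <- sqrt_Rsqr_abs. f_equal; unfold Rsqr; ring.
  - rewrite <- sqrt_0. apply is_lim_seq_continuous; auto.
    apply continuity_pt_sqrt; lra.
Qed.

Definition slope (f f' : R -> R) (a t : R) : R :=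
  if Req_EM_T t a then f' a else (f t - f a) / (t - a).

Lemma slope_eq f f' a t : f t - f a = (t - a) * slope f f' a t.
Proof. unfold slope; destruct (Req_EM_T t a) as [->|]; [ring|field; lra]. Qed.

Lemma slope_continuous (f f' : R -> R) (a t : R) : (forall x, is_derive f x (f' x)) ->
  continuous (slope f f' a) t.
Proof.
  intros Hd. destruct (Req_EM_T t a) as [->|Ht].
  - apply continuity_pt_filterlim, continuity_pt_locally. intros e.
    assert (D := Hd a). apply is_derive_Reals in D.
    destruct (D e (cond_pos e)) as [del Hdel]. exists del. intros y Hy.
    unfold slope. destruct (Req_EM_T a a) as [_|]; [|tauto].
    destruct (Req_EM_T y a) as [->|Hy'].
    + rewrite Rminus_diag, Rabs_R0; apply cond_pos.
    + specialize (Hdel (y - a)). rewrite (Rplus_minus a y) in Hdel.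
      apply Hdel; [lra|exact Hy].
  - apply continuous_ext_loc with (fun t => (f t - f a) / (t - a)).
    + assert (H : 0 < Rabs (t - a)) by (apply Rabs_pos_lt; lra).
      exists (mkposreal _ H). intros y Hy.
      unfold slope. destruct (Req_EM_T y a) as [->|]; auto.
      exfalso. apply Rabs_lt_between' in Hy; simpl in Hy. revert Hy. unfold Rabs.
      destruct (Rcase_abs (t - a)); lra.
    + apply (ex_derive_continuous (fun t => (f t - f a) / (t - a))).
      auto_derive. split; [eexists; apply Hd|lra].
Qed.

(* Chernoff's argument: [psi t - psi t0 = (cos t - cos t0) chi t] with [chi] continuous, so the
   partial sums at [t0] telescope in the cosine coefficients of [chi]. *)
Lemma cosine_series psi : smooth1 psi -> (forall x, x < / 4 -> psi x = 0) ->
  (forall x, 3 < x -> psi x = 0) ->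
  exists c : nat -> R, (forall m, exists C, forall n, INR n ^ m * Rabs (c n) <= C) /\
    forall t0, 0 < t0 < PI -> is_series (fun n => c n * cos (INR n * t0)) (psi t0).
Proof.
  intros Hpsi H0 H3. assert (P := PI_gt3).
  set (a := fun n => IPI (fun t => psi t * cos (INR n * t))).
  set (c := fun n => match n with O => a O / PI | S _ => 2 * a n / PI end).
  exists c; split.
  { intros m. destruct (cosine_coeff_decay m psi Hpsi H0 H3) as [C HC].
    exists C. intros n. destruct (HC n) as [HCn _]. fold (a n) in HCn.
    assert (N : 0 <= INR n ^ m) by apply pow_le, pos_INR.
    eapply Rle_trans; [|exact HCn]. apply Rmult_le_compat_l; auto.
    assert (A0 := Rabs_pos (a n)).
    assert (Ip : / PI < / 3) by (apply Rinv_lt_contravar; lra).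
    assert (Ip0 : 0 < / PI) by (apply Rinv_0_lt_compat; lra).
    unfold c; destruct n as [|n]; unfold Rdiv;
      rewrite !Rabs_mult, (Rabs_pos_eq (/ PI)) by lra; [nra|].
    rewrite (Rabs_pos_eq 2) by lra. nra. }
  intros t0 Ht0.
  destruct (smooth1_derive psi Hpsi) as [psi' [Hd _]].
  assert (Dc : forall x, is_derive cos x (- sin x)) by (intros x; apply is_derive_cos).
  set (sc := slope cos (fun x => - sin x) t0).
  assert (Hsc : forall t, 0 <= t <= PI -> sc t <> 0).
  { intros t Ht. unfold sc, slope. destruct (Req_EM_T t t0) as [->|Hn].
    - assert (0 < sin t0) by (apply sin_gt_0; lra). lra.
    - intros E. apply Hn. apply cos_inj; try lra.
      assert (E' : (cos t - cos t0) / (t - t0) * (t - t0) = 0) by (rewrite E; ring).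
      unfold Rdiv in E'. rewrite Rmult_assoc, Rinv_l in E' by lra. lra. }
  set (chi := fun t => slope psi psi' t0 t * / sc t).
  assert (Hchi : conPI chi).
  { intros t Ht. apply (continuous_mult (slope psi psi' t0) (fun t => / sc t)).
    - apply slope_continuous; auto.
    - apply (continuous_comp sc Rinv).
      + apply slope_continuous; auto.
      + apply continuity_pt_filterlim. apply continuity_pt_inv.
        * apply continuity_pt_id.
        * apply Hsc; auto. }
  assert (Epsi : forall t, 0 <= t <= PI ->
    psi t = psi t0 + (cos t - cos t0) * chi t).
  { intros t Ht. unfold chi.
    rewrite (slope_eq cos (fun x => - sin x) t0 t). fold sc.
    replace ((t - t0) * sc t * (slope psi psi' t0 t * / sc t))
      with ((t - t0) * slope psi psi' t0 t) by (field; apply Hsc; auto).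
    rewrite <- slope_eq. ring. }
  set (d := fun n => IPI (fun t => chi t * cos (INR n * t))).
  assert (Ea : forall n, a (S n) = / 2 * (d (S (S n)) + d n) - cos t0 * d (S n)).
  { intros n. unfold a.
    rewrite (IPI_ext _ (fun t => psi t0 * cos (IZR (Z.of_nat (S n)) * t) +
      (/ 2 * (chi t * cos (INR (S (S n)) * t)) + (/ 2 * (chi t * cos (INR n * t)) +
       - cos t0 * (chi t * cos (INR (S n) * t)))))).
    - rewrite !IPI_plus, !IPI_scal, IPI_cos_IZR; auto 8 with con; [|lia].
      fold (d n) (d (S n)) (d (S (S n))). ring.
    - intros t Ht. rewrite (Epsi t Ht), <- INR_IZR_INZ.
      assert (E := cos_mult_cos (INR (S n) * t) t).
      replace (INR (S n) * t + t) with (INR (S (S n)) * t) in E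
        by (rewrite (S_INR (S n)); ring).
      replace (INR (S n) * t - t) with (INR n * t) in E by (rewrite (S_INR n); ring).
      replace ((psi t0 + (cos t - cos t0) * chi t) * cos (INR (S n) * t)) with
        (psi t0 * cos (INR (S n) * t) + chi t * (cos (INR (S n) * t) * cos t) -
         cos t0 * chi t * cos (INR (S n) * t)) by ring.
      rewrite E. ring. }
  assert (Ea0 : a 0%nat = PI * psi t0 + d 1%nat - cos t0 * d 0%nat).
  { unfold a.
    rewrite (IPI_ext _ (fun t => psi t0 + (chi t * cos (INR 1 * t) +
       - cos t0 * (chi t * cos (INR 0 * t))))).
    - rewrite !IPI_plus, !IPI_scal, IPI_const; auto 8 with con.
      fold (d 0%nat) (d 1%nat). ring.
    - intros t Ht. rewrite (Epsi t Ht). simpl INR.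
      rewrite Rmult_0_l, Rmult_1_l, cos_0. ring. }
  assert (ES : forall N, sum_f_R0 (fun n => c n * cos (INR n * t0)) N = psi t0 +
    / PI * (d (S N) * cos (INR N * t0) - d N * cos (INR (S N) * t0))).
  { induction N as [|N IH].
    - simpl sum_f_R0. unfold c. rewrite Ea0. simpl INR.
      rewrite Rmult_0_l, Rmult_1_l, cos_0. field; lra.
    - rewrite tech5, IH. unfold c. rewrite Ea.
      assert (E := cos_mult_cos (INR (S N) * t0) t0).
      replace (INR (S N) * t0 + t0) with (INR (S (S N)) * t0) in E
        by (rewrite (S_INR (S N)); ring).
      replace (INR (S N) * t0 - t0) with (INR N * t0) in E by (rewrite (S_INR N); ring).
      assert (E' : cos (INR (S (S N)) * t0) =
        2 * (cos (INR (S N) * t0) * cos t0) - cos (INR N * t0)) by lra.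
      rewrite E'. field; lra. }
  assert (Ld : is_lim_seq d 0) by (apply riemann_lebesgue_cos; auto).
  assert (B : forall u v : nat -> R, is_lim_seq u 0 -> is_lim_seq (fun n => u n * cos (v n)) 0).
  { intros u v Hu. apply is_lim_seq_abs_0.
    apply is_lim_seq_le_le with (fun _ => 0) (fun n => Rabs (u n)).
    - intros n; split; [apply Rabs_pos|]. rewrite Rabs_mult.
      assert (Rabs (cos (v n)) <= 1) by (apply Rabs_le, COS_bound).
      assert (A1 := Rabs_pos (u n)). nra.
    - apply is_lim_seq_const.
    - apply is_lim_seq_abs_0 in Hu. auto. }
  assert (L1 : is_lim_seq (fun N => d (S N) * cos (INR N * t0) - d N * cos (INR (S N) * t0))
    (0 - 0)).
  { apply is_lim_seq_minus'.
    - apply (B (fun N => d (S N)) (fun N => INR N * t0)).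
      apply (is_lim_seq_incr_1 d); auto.
    - apply (B d (fun N => INR (S N) * t0)); auto. }
  apply (is_lim_seq_scal_l _ (/ PI) (0 - 0)) in L1.
  apply (is_lim_seq_plus' _ _ (psi t0) (/ PI * (0 - 0)) (is_lim_seq_const (psi t0))) in L1.
  replace (psi t0 + / PI * (0 - 0)) with (psi t0) in L1 by ring.
  enough (L : is_lim_seq (sum_n (fun n => c n * cos (INR n * t0))) (psi t0)) by exact L.
  eapply is_lim_seq_ext; [|exact L1].
  intros N. simpl. rewrite sum_n_Reals. symmetry; apply ES.
Qed.

(** * The harmonic extension *)

Definition has_dx (f fx : pt -> R) :=
  forall p : pt, is_derive (fun t : R => f (t, snd p)) (fst p) (fx p).
Definition has_dy (f fy : pt -> R) :=
  forall p : pt, is_derive (fun t : R => f (fst p, t)) (snd p) (fy p).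

Fixpoint BS2 (n : nat) (f : pt -> R) : Prop :=
  (exists M, forall p, Rabs (f p) <= M) /\
  match n with
  | O => True
  | S m => exists fx fy : pt -> R, has_dx f fx /\ has_dy f fy /\ BS2 m fx /\ BS2 m fy
  end.

Definition bsmooth2 (f : pt -> R) := forall n, BS2 n f.

Lemma has_dx_unique f g h : has_dx f g -> has_dx f h -> g = h.
Proof.
  intros Hg Hh. apply functional_extensionality; intros p.
  rewrite <- (is_derive_unique _ _ _ (Hg p)). apply is_derive_unique, Hh.
Qed.

Lemma has_dy_unique f g h : has_dy f g -> has_dy f h -> g = h.
Proof.
  intros Hg Hh. apply functional_extensionality; intros p.
  rewrite <- (is_derive_unique _ _ _ (Hg p)). apply is_derive_unique, Hh.
Qed.

Lemma bsmooth2_partials f fx fy : bsmooth2 f -> has_dx f fx -> has_dy f fy ->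
  bsmooth2 fx /\ bsmooth2 fy.
Proof.
  intros Hf Hx Hy. split; intros n; destruct (Hf (S n)) as [_ [gx [gy [H1 [H2 [H3 H4]]]]]].
  - rewrite (has_dx_unique _ _ _ Hx H1); auto.
  - rewrite (has_dy_unique _ _ _ Hy H2); auto.
Qed.

Definition rapid (c : nat -> R) :=
  forall m, exists C, forall n, INR n ^ m * Rabs (c n) <= C.

Lemma rapid_INR c : rapid c -> rapid (fun n => INR n * c n).
Proof.
  intros H m. destruct (H (S m)) as [C HC]. exists C. intros n.
  rewrite Rabs_mult, (Rabs_pos_eq (INR n)) by apply pos_INR.
  specialize (HC n). simpl in HC. lra.
Qed.

Lemma rapid_scal c d : rapid c -> rapid (fun n => d * c n).
Proof.
  intros H m. destruct (H m) as [C HC]. exists (Rabs d * C). intros n.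
  rewrite Rabs_mult, <- Rmult_assoc, (Rmult_comm _ (Rabs d)), Rmult_assoc.
  apply Rmult_le_compat_l; auto using Rabs_pos.
Qed.

Lemma ex_series_telescope : ex_series (fun n => / ((INR n + 1) * (INR n + 2))).
Proof.
  assert (E : forall n, sum_f_R0 (fun n => / ((INR n + 1) * (INR n + 2))) n
    = 1 - / (INR n + 2)).
  { induction n as [|n IH]; [simpl; lra|].
    rewrite tech5, IH, S_INR. assert (H := pos_INR n). field; lra. }
  destruct (ex_finite_lim_seq_incr
    (sum_f_R0 (fun n => / ((INR n + 1) * (INR n + 2)))) 1) as [l Hl].
  - intros n. rewrite tech5. assert (H := pos_INR (S n)).
    assert (0 < / ((INR (S n) + 1) * (INR (S n) + 2)))
      by (apply Rinv_0_lt_compat, Rmult_lt_0_compat; lra). lra.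
  - intros n. rewrite E. assert (H := pos_INR n).
    assert (0 < / (INR n + 2)) by (apply Rinv_0_lt_compat; lra). lra.
  - exists l. assert (L : is_lim_seq (sum_n (fun n => / ((INR n + 1) * (INR n + 2)))) l); auto.
    apply is_lim_seq_ext with (2 := Hl). intros n; symmetry; apply sum_n_Reals.
Qed.

Lemma rapid_summable c M : rapid c -> ex_series (fun n => Rabs (c n) * M).
Proof.
  intros H. destruct (H 0%nat) as [C0 H0]; destruct (H 1%nat) as [C1 H1];
    destruct (H 2%nat) as [C2 H2].
  apply (ex_series_scal_r M (fun n => Rabs (c n))).
  apply (ex_series_le (fun n => Rabs (c n))
    (fun n => / ((INR n + 1) * (INR n + 2)) * (C2 + 3 * C1 + 2 * C0))).
  - intros n. unfold norm; simpl; unfold abs; simpl. rewrite Rabs_Rabsolu.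
    specialize (H0 n); specialize (H1 n); specialize (H2 n); simpl in H0, H1, H2.
    assert (N := pos_INR n).
    assert (P : 0 < (INR n + 1) * (INR n + 2)) by (apply Rmult_lt_0_compat; lra).
    apply Rmult_le_reg_l with ((INR n + 1) * (INR n + 2)); auto.
    rewrite <- Rmult_assoc, Rinv_r, Rmult_1_l by lra. lra.
  - apply (ex_series_scal_r (C2 + 3 * C1 + 2 * C0)). apply ex_series_telescope.
Qed.

Lemma bsmooth_bound f : bsmooth f -> exists M, 0 <= M /\ forall x, Rabs (f x) <= M.
Proof.
  intros H. destruct (H 0%nat) as [[M HM] _]. exists M; split; auto.
  eapply Rle_trans; [apply Rabs_pos|apply (HM 0)].
Qed.

Definition wave (c : nat -> R) (A B : R -> R) (p : pt) : R :=
  Series (fun k => c k * (A (INR k * (fst p + 3 / 2)) * B (INR k * snd p))).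

Lemma wave_term_bound (c a b MA MB : R) : Rabs a <= MA -> Rabs b <= MB -> 0 <= MA ->
  Rabs (c * (a * b)) <= Rabs c * (MA * MB).
Proof.
  intros Ha Hb HM. rewrite !Rabs_mult. apply Rmult_le_compat_l; [apply Rabs_pos|].
  apply Rmult_le_compat; auto using Rabs_pos.
Qed.

Lemma wave_summable c A B p : rapid c -> bsmooth A -> bsmooth B ->
  ex_series (fun k => c k * (A (INR k * (fst p + 3 / 2)) * B (INR k * snd p))).
Proof.
  intros Hc HA HB.
  destruct (bsmooth_bound A HA) as [MA [A0 HMA]]; destruct (bsmooth_bound B HB) as [MB [B0 HMB]].
  eapply Series_abs_le; [intros k; apply wave_term_bound; [apply HMA|apply HMB|auto]|].
  apply (rapid_summable c (MA * MB)); auto.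
Qed.

Lemma wave_bounded c A B : rapid c -> bsmooth A -> bsmooth B ->
  exists M, forall p, Rabs (wave c A B p) <= M.
Proof.
  intros Hc HA HB.
  destruct (bsmooth_bound A HA) as [MA [A0 HMA]]; destruct (bsmooth_bound B HB) as [MB [B0 HMB]].
  exists (Series (fun k => Rabs (c k) * (MA * MB))). intros p.
  apply Series_abs_le; [intros k; apply wave_term_bound; auto|].
  apply rapid_summable; auto.
Qed.

Lemma wave_dx c A A' B : rapid c -> bsmooth A -> bsmooth A' -> bsmooth B ->
  (forall x, is_derive A x (A' x)) ->
  has_dx (wave c A B) (wave (fun k => INR k * c k) A' B).
Proof.
  intros Hc HA HA' HB HD [x y]. unfold wave; simpl.
  destruct (bsmooth_derive A' HA') as [A'' [HD' HA'']].
  destruct (bsmooth_bound A HA) as [MA [A0 HMA]]; destruct (bsmooth_bound B HB) as [MB [B0 HMB]].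
  destruct (bsmooth_bound A' HA') as [MA' [A0' HMA']].
  destruct (bsmooth_bound A'' HA'') as [MA'' [A0'' HMA'']].
  apply (is_derive_Series
    (fun k t => c k * (A (INR k * (t + 3 / 2)) * B (INR k * y)))
    (fun k t => INR k * c k * (A' (INR k * (t + 3 / 2)) * B (INR k * y)))
    (fun k t => INR k * (INR k * c k) * (A'' (INR k * (t + 3 / 2)) * B (INR k * y)))
    (fun k => Rabs (c k) * (MA * MB)) (fun k => Rabs (INR k * c k) * (MA' * MB))
    (fun k => Rabs (INR k * (INR k * c k)) * (MA'' * MB))).
  1,2: intros k t; auto_derive; [repeat split; eexists; eauto|].
  1: rewrite (is_derive_unique _ _ _ (HD _)); ring.
  1: rewrite (is_derive_unique _ _ _ (HD' _)); ring.
  1,2,3: intros; apply wave_term_bound; auto.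
  all: apply rapid_summable; auto using rapid_INR.
Qed.

Lemma wave_dy c A B B' : rapid c -> bsmooth A -> bsmooth B -> bsmooth B' ->
  (forall x, is_derive B x (B' x)) ->
  has_dy (wave c A B) (wave (fun k => INR k * c k) A B').
Proof.
  intros Hc HA HB HB' HD [x y]. unfold wave; simpl.
  destruct (bsmooth_derive B' HB') as [B'' [HD' HB'']].
  destruct (bsmooth_bound A HA) as [MA [A0 HMA]]; destruct (bsmooth_bound B HB) as [MB [B0 HMB]].
  destruct (bsmooth_bound B' HB') as [MB' [B0' HMB']].
  destruct (bsmooth_bound B'' HB'') as [MB'' [B0'' HMB'']].
  apply (is_derive_Series
    (fun k t => c k * (A (INR k * (x + 3 / 2)) * B (INR k * t)))
    (fun k t => INR k * c k * (A (INR k * (x + 3 / 2)) * B' (INR k * t)))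
    (fun k t => INR k * (INR k * c k) * (A (INR k * (x + 3 / 2)) * B'' (INR k * t)))
    (fun k => Rabs (c k) * (MA * MB)) (fun k => Rabs (INR k * c k) * (MA * MB'))
    (fun k => Rabs (INR k * (INR k * c k)) * (MA * MB''))).
  1,2: intros k t; auto_derive; [repeat split; eexists; eauto|].
  1: rewrite (is_derive_unique _ _ _ (HD _)); ring.
  1: rewrite (is_derive_unique _ _ _ (HD' _)); ring.
  1,2,3: intros; apply wave_term_bound; auto.
  all: apply rapid_summable; auto using rapid_INR.
Qed.

Lemma bsmooth2_wave c A B : rapid c -> bsmooth A -> bsmooth B -> bsmooth2 (wave c A B).
Proof.
  intros Hc HA HB n; revert c A B Hc HA HB; induction n as [|n IH]; intros c A B Hc HA HB.
  all: split; auto using wave_bounded.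
  destruct (bsmooth_derive A HA) as [A' [HDA HA']].
  destruct (bsmooth_derive B HB) as [B' [HDB HB']].
  exists (wave (fun k => INR k * c k) A' B), (wave (fun k => INR k * c k) A B').
  split; [apply wave_dx; auto|]. split; [apply wave_dy; auto|].
  split; apply IH; auto using rapid_INR.
Qed.

Lemma wave_scal d c A B p : wave (fun k => d * c k) A B p = d * wave c A B p.
Proof.
  unfold wave. rewrite <- Series_scal_l. apply Series_ext; intros k; ring.
Qed.

Lemma expcut_second_derivative E' E'' t : (forall x, is_derive expcut x (E' x)) ->
  (forall x, is_derive E' x (E'' x)) -> 0 < t -> E'' t = expcut t.
Proof.
  intros H1 H2 Ht.
  assert (HE' : forall s, 0 < s -> E' s = - exp (- s)).
  { intros s Hs. rewrite <- (is_derive_unique _ _ _ (H1 s)).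
    rewrite (Derive_ext_loc expcut (fun t => exp (- t))).
    - apply is_derive_unique. auto_derive; auto; ring.
    - exists (mkposreal s Hs). intros y Hy.
      apply Rabs_lt_between' in Hy; simpl in Hy. apply expcut_right; lra. }
  rewrite <- (is_derive_unique _ _ _ (H2 t)).
  rewrite (Derive_ext_loc E' (fun t => - exp (- t))).
  - rewrite expcut_right by lra. apply is_derive_unique. auto_derive; auto; ring.
  - exists (mkposreal t Ht). intros y Hy.
    apply Rabs_lt_between' in Hy; simpl in Hy. apply HE'; lra.
Qed.

Lemma harmonic_perturbation (Z : R -> Prop) : closed1 Z ->
  exists W Wx Wy Wxx Wyy : pt -> R,
    bsmooth2 W /\ has_dx W Wx /\ has_dy W Wy /\ has_dx Wx Wxx /\ has_dy Wy Wyy /\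
    (forall p, 0 < snd p -> Wxx p + Wyy p = 0) /\
    (forall p, Rabs (W p) <= / 4) /\ (forall p, Rabs (Wy p) <= / 2) /\
    (forall x, -1 <= x <= 1 -> 0 <= W (x, 0) /\ (W (x, 0) = 0 <-> Z x)).
Proof.
  intros HZ. assert (P := PI_gt3).
  set (Z' := fun t => t <= / 4 \/ 3 <= t \/ Z (t - 3 / 2)).
  destruct (closed_set_smooth_function Z') as [psi [Hs [H0 Hz]]].
  { intros x Hx. apply Classical_Prop.NNPP; intros Hno. unfold Z' in Hno.
    assert (Hn : ~ closure1 Z (x - 3 / 2)) by (intros Hc; apply HZ in Hc; tauto).
    apply Hn. intros e He.
    assert (x > / 4) by (apply Rnot_le_gt; tauto).
    assert (x < 3) by (apply Rnot_le_lt; tauto).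
    destruct (Hx (Rmin e (Rmin (x - / 4) (3 - x)))) as [y [Hy Hd]].
    { repeat apply Rmin_glb_lt; lra. }
    assert (M1 := Rmin_l e (Rmin (x - / 4) (3 - x))).
    assert (M2 := Rmin_r e (Rmin (x - / 4) (3 - x))).
    assert (M3 := Rmin_l (x - / 4) (3 - x)).
    assert (M4 := Rmin_r (x - / 4) (3 - x)).
    assert (Hd' := Hd). apply Rabs_lt_between in Hd'.
    destruct Hy as [Hy|[Hy|Hy]]; try lra.
    exists (y - 3 / 2); split; auto.
    replace (x - 3 / 2 - (y - 3 / 2)) with (x - y) by ring. lra. }
  { intros x Hx; left; lra. }
  destruct (cosine_series psi Hs) as [c [Hc HS]].
  { intros x Hx. apply Hz. left; lra. }
  { intros x Hx. apply Hz. right; left; lra. }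
  change (rapid c) in Hc.
  assert (Bc : bsmooth cos) by (intros n; apply Bn_cos_sin).
  assert (Bms : bsmooth (fun x => -1 * sin x)) by (intros n; apply Bn_scal, Bn_cos_sin).
  assert (Bmc : bsmooth (fun x => -1 * cos x)) by (intros n; apply Bn_scal, Bn_cos_sin).
  assert (BE := bsmooth_expcut).
  destruct (bsmooth_derive expcut BE) as [E' [DE BE']].
  destruct (bsmooth_derive E' BE') as [E'' [DE' BE'']].
  assert (Dc : forall x, is_derive cos x (-1 * sin x))
    by (intros x; auto_derive; auto; ring).
  assert (Ds : forall x, is_derive (fun x => -1 * sin x) x (-1 * cos x))
    by (intros x; auto_derive; auto; ring).
  destruct (wave_bounded c cos expcut) as [M0 HM0]; auto.
  destruct (wave_bounded (fun k => INR k * c k) cos E') as [M1 HM1]; auto using rapid_INR.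
  assert (M0p : 0 <= M0) by (eapply Rle_trans; [apply Rabs_pos|apply (HM0 (0, 0))]).
  assert (M1p : 0 <= M1) by (eapply Rle_trans; [apply Rabs_pos|apply (HM1 (0, 0))]).
  set (d := / (4 * (M0 + M1 + 1))).
  assert (Hd0 : 0 < d) by (apply Rinv_0_lt_compat; lra).
  assert (Hd : d * (M0 + M1 + 1) = / 4) by (unfold d; field; lra).
  set (c0 := fun k => d * c k).
  assert (Hc0 : rapid c0) by (apply rapid_scal; auto).
  exists (wave c0 cos expcut), (wave (fun k => INR k * c0 k) (fun x => -1 * sin x) expcut),
    (wave (fun k => INR k * c0 k) cos E'),
    (wave (fun k => INR k * (INR k * c0 k)) (fun x => -1 * cos x) expcut),
    (wave (fun k => INR k * (INR k * c0 k)) cos E'').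
  split; [apply bsmooth2_wave; auto|].
  split; [apply wave_dx; auto|].
  split; [apply wave_dy; auto|].
  split; [apply (wave_dx (fun k => INR k * c0 k)); auto using rapid_INR|].
  split; [apply (wave_dy (fun k => INR k * c0 k)); auto using rapid_INR|].
  split; [|split; [|split]].
  - intros p Hp. unfold wave. rewrite <- Series_plus.
    2: apply (wave_summable (fun k => INR k * (INR k * c0 k)) (fun x => -1 * cos x) expcut);
      auto using rapid_INR.
    2: apply (wave_summable (fun k => INR k * (INR k * c0 k)) cos E''); auto using rapid_INR.
    rewrite (Series_ext _ (fun _ => 0 * 0)); [rewrite Series_scal_l; ring|].
    intros k. destruct k as [|k]; [simpl; ring|].
    rewrite (expcut_second_derivative E' E''); auto; [ring|].
    apply Rmult_lt_0_compat; auto. apply lt_0_INR; lia.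
  - intros p. unfold c0. rewrite wave_scal, Rabs_mult, (Rabs_pos_eq d) by lra.
    specialize (HM0 p). nra.
  - intros p. unfold c0.
    replace (fun k => INR k * (d * c k)) with (fun k => d * (INR k * c k))
      by (apply functional_extensionality; intros; ring).
    rewrite wave_scal, Rabs_mult, (Rabs_pos_eq d) by lra.
    specialize (HM1 p). nra.
  - intros x Hx. unfold c0. rewrite wave_scal.
    assert (E : wave c cos expcut (x, 0) = psi (x + 3 / 2)).
    { unfold wave; simpl. rewrite <- (is_series_unique _ _ (HS (x + 3 / 2) ltac:(lra))).
      apply Series_ext. intros k. rewrite Rmult_0_r, expcut_right by lra.
      rewrite Ropp_0, exp_0. ring. }
    rewrite E. split; [apply Rmult_le_pos; auto; lra|].
    assert (HZx : psi (x + 3 / 2) = 0 <-> Z x).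
    { rewrite Hz. unfold Z'. replace (x + 3 / 2 - 3 / 2) with x by ring. split; auto.
      intros [H|[H|H]]; auto; lra. }
    rewrite <- HZx. split; intros H; [|rewrite H; ring].
    apply Rmult_integral in H. destruct H; lra.
Qed.

(** * Calculus in the plane *)

Lemma edist_fst p q : Rabs (fst p - fst q) <= edist p q.
Proof.
  unfold edist. rewrite <- sqrt_Rsqr_abs. apply sqrt_le_1_alt. unfold Rsqr.
  assert (H := pow2_ge_0 (snd p - snd q)). lra.
Qed.

Lemma edist_snd p q : Rabs (snd p - snd q) <= edist p q.
Proof.
  unfold edist. rewrite <- sqrt_Rsqr_abs. apply sqrt_le_1_alt. unfold Rsqr.
  assert (H := pow2_ge_0 (fst p - fst q)). lra.
Qed.

Lemma edist_le_sum p q : edist p q <= Rabs (fst p - fst q) + Rabs (snd p - snd q).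
Proof.
  unfold edist. set (a := fst p - fst q); set (b := snd p - snd q).
  assert (A := Rabs_pos a). assert (B := Rabs_pos b).
  rewrite <- (sqrt_Rsqr (Rabs a + Rabs b)) by lra. apply sqrt_le_1_alt. unfold Rsqr.
  rewrite <- (pow2_abs a), <- (pow2_abs b). nra.
Qed.

Lemma edist_nonneg p q : 0 <= edist p q.
Proof. apply sqrt_pos. Qed.

Lemma edist_sym p q : edist p q = edist q p.
Proof. unfold edist; f_equal; ring. Qed.

Lemma edist_triangle p q r : edist p q <= edist p r + edist r q.
Proof.
  assert (H := triangle (fst p) (snd p) (fst q) (snd q) (fst r) (snd r)).
  unfold dist_euc in H. rewrite !Rsqr_pow2 in H. exact H.
Qed.

Lemma edist_self p : edist p p = 0.
Proof.
  unfold edist. rewrite !Rminus_diag. replace (0 ^ 2 + 0 ^ 2) with 0 by ring. apply sqrt_0.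
Qed.

Definition open2 (V : pt -> Prop) :=
  forall p, V p -> exists e, 0 < e /\ forall q, edist p q < e -> V q.

Lemma open2_Bone : open2 Bone.
Proof.
  intros p Hp. unfold Bone, eball in *. exists (1 - edist p (0, 0)); split; [lra|].
  intros q Hq. assert (H := edist_triangle q (0, 0) p). rewrite (edist_sym q p) in H. lra.
Qed.

Lemma Bone_iff x y : Bone (x, y) <-> x ^ 2 + y ^ 2 < 1.
Proof.
  unfold Bone, eball, edist; simpl fst; simpl snd. rewrite !Rminus_0_r.
  rewrite <- sqrt_1 at 1. split; intros H.
  - apply sqrt_lt_0_alt in H; auto.
  - apply sqrt_lt_1_alt; split; auto. assert (A := pow2_ge_0 x).
    assert (B := pow2_ge_0 y). lra.
Qed.

Lemma locally_edist (p : pt) (P : pt -> Prop) (e : R) : 0 < e ->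
  (forall q, edist p q < e -> P q) -> locally p P.
Proof.
  intros He H. assert (H2 : 0 < e / 2) by lra.
  exists (mkposreal _ H2). destruct p as [x y]. intros [x' y'] [B1 B2]. apply H.
  rewrite edist_sym. eapply Rle_lt_trans; [apply edist_le_sum|]. simpl.
  change (Rabs (x' - x) < e / 2) in B1. change (Rabs (y' - y) < e / 2) in B2.
  lra.
Qed.

Lemma lip_of_partials f fx fy M : has_dx f fx -> has_dy f fy ->
  (forall p, Rabs (fx p) <= M) -> (forall p, Rabs (fy p) <= M) ->
  forall p q, Rabs (f p - f q) <= M * (Rabs (fst p - fst q) + Rabs (snd p - snd q)).
Proof.
  intros Hx Hy Mx My [x y] [x' y']; simpl.
  replace (f (x, y) - f (x', y')) with
    ((f (x, y) - f (x', y)) + (f (x', y) - f (x', y'))) by ring.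
  eapply Rle_trans; [apply Rabs_triang|]. rewrite Rmult_plus_distr_l.
  apply Rplus_le_compat.
  - apply (lip_of_derive (fun t => f (t, y)) (fun t => fx (t, y))); auto.
    intros t; apply (Hx (t, y)).
  - apply (lip_of_derive (fun t => f (x', t)) (fun t => fy (x', t))); auto.
    intros t; apply (Hy (x', t)).
Qed.

Lemma continuous_of_lip (f : pt -> R) M (p : pt) :
  (forall p q, Rabs (f p - f q) <= M * (Rabs (fst p - fst q) + Rabs (snd p - snd q))) ->
  continuous f p.
Proof.
  intros H. apply filterlim_locally. intros e.
  assert (HM : 0 < 2 * (Rabs M + 1)) by (assert (A := Rabs_pos M); lra).
  apply locally_edist with (e / (2 * (Rabs M + 1))).
  { apply Rdiv_lt_0_compat; auto; apply cond_pos. }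
  intros q Hq. change (Rabs (f q - f p) < e).
  eapply Rle_lt_trans; [apply H|].
  assert (A1 := edist_fst q p); assert (A2 := edist_snd q p). rewrite edist_sym in Hq.
  assert (B1 := Rabs_pos (fst q - fst p)). assert (B2 := Rabs_pos (snd q - snd p)).
  apply Rle_lt_trans with ((Rabs M + 1) * (2 * edist q p)).
  - apply Rle_trans with ((Rabs M + 1) * (Rabs (fst q - fst p) + Rabs (snd q - snd p))).
    + apply Rmult_le_compat_r; [lra|]. assert (H' := Rle_abs M); lra.
    + apply Rmult_le_compat_l; lra.
  - apply Rmult_lt_compat_r with (r := 2 * (Rabs M + 1)) in Hq; auto.
    unfold Rdiv in Hq; rewrite Rmult_assoc, Rinv_l, Rmult_1_r in Hq by lra. lra.
Qed.

Fixpoint S2 (n : nat) (f : pt -> R) : Prop :=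
  (forall p : pt, continuous f p) /\
  match n with
  | O => True
  | S m => exists fx fy : pt -> R, has_dx f fx /\ has_dy f fy /\ S2 m fx /\ S2 m fy
  end.

Lemma S2_continuous n f (p : pt) : S2 n f -> continuous f p.
Proof. destruct n; intros [H _]; auto. Qed.

Lemma S2_le n m f : (m <= n)%nat -> S2 n f -> S2 m f.
Proof.
  revert m f; induction n as [|n IH]; intros [|m] f H [H1 H2]; split; auto; try lia.
  destruct H2 as [fx [fy [A [B [C D]]]]]. exists fx, fy.
  refine (conj _ (conj _ (conj _ _))); auto; apply IH; auto; lia.
Qed.

Lemma BS2_S2 n f : BS2 (S n) f -> S2 n f.
Proof.
  revert f; induction n as [|n IH]; intros f [_ [fx [fy [Hx [Hy [Bx By]]]]]].
  all: assert (Hc : forall p : pt, continuous f p).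
  1,3: destruct Bx as [[M1 H1] _]; destruct By as [[M2 H2] _]; intros p;
    apply continuous_of_lip with (Rmax M1 M2); apply (lip_of_partials f fx fy); auto;
    intros q; [eapply Rle_trans; [apply H1|apply Rmax_l]|eapply Rle_trans; [apply H2|apply Rmax_r]].
  all: split; auto. exists fx, fy; refine (conj _ (conj _ (conj _ _))); auto.
Qed.

Lemma S2_const n c : S2 n (fun _ => c).
Proof.
  revert c; induction n; intros c; split; auto; try (intros p; apply continuous_const).
  exists (fun _ => 0), (fun _ => 0).
  refine (conj _ (conj _ (conj _ _))); auto; intros p; auto_derive; auto.
Qed.

Lemma S2_snd n : S2 n (fun p => snd p).
Proof.
  destruct n; split; auto; try (intros p; apply continuous_snd).
  exists (fun _ => 0), (fun _ => 1). refine (conj _ (conj _ (conj _ _))); auto using S2_const.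
  - intros p; simpl; auto_derive; auto.
  - intros p; simpl; auto_derive; auto.
Qed.

Lemma S2_plus n f g : S2 n f -> S2 n g -> S2 n (fun p => f p + g p).
Proof.
  revert f g; induction n as [|n IH]; intros f g [Cf Hf] [Cg Hg]; split; auto;
    try (intros p; apply (continuous_plus f g); auto).
  destruct Hf as [fx [fy [A1 [A2 [A3 A4]]]]]; destruct Hg as [gx [gy [B1 [B2 [B3 B4]]]]].
  exists (fun p => fx p + gx p), (fun p => fy p + gy p). refine (conj _ (conj _ (conj _ _))); auto.
  - intros p. apply (is_derive_plus (fun t => f (t, snd p)) (fun t => g (t, snd p))); auto.
  - intros p. apply (is_derive_plus (fun t => f (fst p, t)) (fun t => g (fst p, t))); auto.
Qed.

Lemma S2_mult n f g : S2 n f -> S2 n g -> S2 n (fun p => f p * g p).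
Proof.
  revert f g; induction n as [|n IH]; intros f g Sf Sg.
  - destruct Sf as [Cf _]; destruct Sg as [Cg _]. split; auto.
    intros p; apply (continuous_mult f g); auto.
  - assert (Sf' := S2_le (S n) n f ltac:(lia) Sf).
    assert (Sg' := S2_le (S n) n g ltac:(lia) Sg).
    destruct Sf as [Cf Hf]; destruct Sg as [Cg Hg]. split.
    { intros p; apply (continuous_mult f g); auto. }
    destruct Hf as [fx [fy [A1 [A2 [A3 A4]]]]]; destruct Hg as [gx [gy [B1 [B2 [B3 B4]]]]].
    exists (fun p => fx p * g p + f p * gx p), (fun p => fy p * g p + f p * gy p).
    refine (conj _ (conj _ (conj _ _))); auto using S2_plus.
    + intros [x y].
      apply (is_derive_mult (fun t => f (t, y)) (fun t => g (t, y)) x (fx (x, y)) (gx (x, y))).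
      * apply (A1 (x, y)).
      * apply (B1 (x, y)).
      * intros; apply Rmult_comm.
    + intros [x y].
      apply (is_derive_mult (fun t => f (x, t)) (fun t => g (x, t)) y (fy (x, y)) (gy (x, y))).
      * apply (A2 (x, y)).
      * apply (B2 (x, y)).
      * intros; apply Rmult_comm.
Qed.

Definition refl2 (p : pt) : pt := (fst p, - snd p).

Lemma has_dx_refl f fx : has_dx f fx -> has_dx (fun p => f (refl2 p)) (fun p => fx (refl2 p)).
Proof. intros H p. apply (H (refl2 p)). Qed.

Lemma has_dy_refl f fy : has_dy f fy ->
  has_dy (fun p => f (refl2 p)) (fun p => -1 * fy (refl2 p)).
Proof.
  intros H p. unfold refl2; simpl.
  apply (is_derive_comp (fun t => f (fst p, t)) (fun t => - t)).
  - apply (H (fst p, - snd p)).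
  - auto_derive; auto.
Qed.

Lemma S2_refl n f : S2 n f -> S2 n (fun p => f (refl2 p)).
Proof.
  assert (Cr : forall (f : pt -> R) (p : pt), (forall q : pt, continuous f q) ->
    continuous (fun p => f (refl2 p)) p).
  { intros h p Hh. apply (continuous_comp refl2 h); auto.
    apply filterlim_locally. intros e.
    apply locally_edist with e; [apply cond_pos|]. intros q Hq.
    rewrite edist_sym in Hq. split.
    - change (Rabs (fst q - fst p) < e).
      eapply Rle_lt_trans; [apply edist_fst|exact Hq].
    - change (Rabs (- snd q - - snd p) < e).
      replace (- snd q - - snd p) with (- (snd q - snd p)) by ring. rewrite Rabs_Ropp.
      eapply Rle_lt_trans; [apply edist_snd|exact Hq]. }
  revert f; induction n as [|n IH]; intros f [Cf Hf]; split; auto.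
  destruct Hf as [fx [fy [A1 [A2 [A3 A4]]]]].
  exists (fun p => fx (refl2 p)), (fun p => -1 * fy (refl2 p)).
  split; [apply has_dx_refl; auto|]. split; [apply has_dy_refl; auto|].
  split; auto. apply S2_mult; auto using S2_const.
Qed.

Lemma S2_of_snd n (f : R -> R) : Cn (S n) f -> S2 n (fun p => f (snd p)).
Proof.
  revert f; induction n as [|n IH]; intros f Hf.
  all: split; [intros p; apply (continuous_comp (fun p : pt => snd p) f);
    [apply continuous_snd|eapply Cn_continuous; exact Hf]|auto].
  destruct Hf as [f' [Hd Hf']].
  exists (fun _ => 0), (fun p => f' (snd p)).
  refine (conj _ (conj _ (conj _ _))); auto using S2_const.
  - intros p; simpl; auto_derive; auto.
  - intros p; apply (Hd (snd p)).
Qed.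

Lemma Dx_eq f fx : has_dx f fx -> Defs.Dx f = fx.
Proof.
  intros H. apply functional_extensionality; intros p. apply is_derive_unique, H.
Qed.

Lemma Dy_eq f fy : has_dy f fy -> Defs.Dy f = fy.
Proof.
  intros H. apply functional_extensionality; intros p. apply is_derive_unique, H.
Qed.

Lemma S2_pdw n w f : S2 (length w + n) f -> S2 n (pdw w f).
Proof.
  revert n; induction w as [|b w IH]; intros n H; auto. simpl.
  assert (H' : S2 (S n) (pdw w f)).
  { apply IH. replace (length w + S n)%nat with (length (b :: w) + n)%nat by (simpl; lia). auto. }
  destruct H' as [_ [gx [gy [H1 [H2 [H3 H4]]]]]].
  destruct b; [rewrite (Dx_eq _ _ H1)|rewrite (Dy_eq _ _ H2)]; auto.
Qed.

Lemma S2_Ck_on k f U : S2 k f -> Ck_on k f U.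
Proof.
  intros H w Hw p _. split.
  - apply (S2_continuous 0). apply S2_pdw. apply S2_le with k; auto; lia.
  - intros Hlt. assert (H' : S2 1 (pdw w f)) by (apply S2_pdw; apply S2_le with k; auto; lia).
    destruct H' as [_ [gx [gy [H1 [H2 _]]]]]. split; eexists; [apply H1|apply H2].
Qed.

Lemma open2_lines V (p : pt) : open2 V -> V p ->
  locally (fst p) (fun t => V (t, snd p)) /\ locally (snd p) (fun t => V (fst p, t)).
Proof.
  intros HV Hp. destruct (HV p Hp) as [e [He H]].
  split; exists (mkposreal e He); intros t Ht; apply H; rewrite edist_sym;
    (eapply Rle_lt_trans; [apply edist_le_sum|]); simpl; rewrite Rminus_diag, Rabs_R0.
  - rewrite Rplus_0_r; exact Ht.
  - rewrite Rplus_0_l; exact Ht.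
Qed.

Lemma pdw_ext_open V f g : open2 V -> (forall p, V p -> f p = g p) ->
  forall w p, V p -> pdw w f p = pdw w g p.
Proof.
  intros HV H; induction w as [|b w IH]; intros p Hp; [auto|].
  destruct (open2_lines V p HV Hp) as [L1 L2].
  destruct b; simpl; apply Derive_ext_loc.
  - eapply filter_imp; [|exact L1]. intros t Ht; apply (IH (t, snd p) Ht).
  - eapply filter_imp; [|exact L2]. intros t Ht; apply (IH (fst p, t) Ht).
Qed.

Lemma Ck_on_ext_open k V f g : open2 V -> (forall p, V p -> f p = g p) ->
  Ck_on k g V -> Ck_on k f V.
Proof.
  intros HV H HC w Hw p Hp. destruct (HC w Hw p Hp) as [C1 C2].
  assert (E := pdw_ext_open V f g HV H w).
  destruct (HV p Hp) as [e [He HV']].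
  split.
  - apply continuous_ext_loc with (pdw w g); auto.
    apply locally_edist with e; auto. intros q Hq; symmetry; apply E; auto.
  - intros Hlt. destruct (C2 Hlt) as [D1 D2].
    destruct (open2_lines V p HV Hp) as [L1 L2]. split.
    + eapply ex_derive_ext_loc; [|exact D1].
      eapply filter_imp; [|exact L1]. intros t Ht; symmetry; apply (E (t, snd p) Ht).
    + eapply ex_derive_ext_loc; [|exact D2].
      eapply filter_imp; [|exact L2]. intros t Ht; symmetry; apply (E (fst p, t) Ht).
Qed.

Lemma analytic_minus f g U : analytic_on f U -> analytic_on g U ->
  analytic_on (fun p => f p - g p) U.
Proof.
  intros Hf Hg p Hp. destruct (Hf p Hp) as [r1 [R1 [a Ha]]].
  destruct (Hg p Hp) as [r2 [R2 [b Hb]]].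
  exists (Rmin r1 r2); split; [apply Rmin_glb_lt; auto|].
  exists (fun i j => a i j - b i j). intros q Hq dx dy.
  destruct (Ha q) as [A1 A2]; [eapply Rlt_le_trans; [exact Hq|apply Rmin_l]|].
  destruct (Hb q) as [B1 B2]; [eapply Rlt_le_trans; [exact Hq|apply Rmin_r]|].
  fold dx dy in A1, A2, B1, B2.
  assert (Ab : forall c : nat -> nat -> R, forall n,
    Rabs (sum_f_R0 (fun i => c i (n - i)%nat * dx ^ i * dy ^ (n - i)) n) <=
    sum_f_R0 (fun i => Rabs (c i (n - i)%nat) * Rabs dx ^ i * Rabs dy ^ (n - i)) n).
  { intros c n. eapply Rle_trans; [apply Rsum_abs|]. right.
    apply sum_eq. intros i _. rewrite !Rabs_mult, !RPow_abs; auto. }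
  assert (A3 := proj1 (Series_abs_le _ _ (Ab a) A1)).
  assert (B3 := proj1 (Series_abs_le _ _ (Ab b) B1)).
  split.
  - refine (ex_series_le _ _ _ (ex_series_plus _ _ A1 B1)).
    intros n. unfold norm, plus; simpl; unfold abs; simpl. rewrite <- plus_sum.
    rewrite Rabs_pos_eq.
    + apply sum_Rle. intros i _. rewrite <- !Rmult_plus_distr_r.
      assert (0 <= Rabs dx ^ i) by (apply pow_le, Rabs_pos).
      assert (0 <= Rabs dy ^ (n - i)) by (apply pow_le, Rabs_pos).
      do 2 (apply Rmult_le_compat_r; auto).
      unfold Rminus; eapply Rle_trans; [apply Rabs_triang|]. rewrite Rabs_Ropp; lra.
    + apply cond_pos_sum. intros i.
      repeat apply Rmult_le_pos; try apply pow_le; apply Rabs_pos.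
  - rewrite A2, B2, <- Series_minus; auto. apply Series_ext. intros n.
    rewrite <- minus_sum. apply sum_eq. intros i _. ring.
Qed.

Lemma PSeries_left_zero n : forall (b : nat -> R) (r : R), 0 < r ->
  Rbar_lt r (CV_radius b) -> (forall s, - r < s < 0 -> PSeries b s = 0) -> b n = 0.
Proof.
  induction n as [|n IH]; intros b r Hr HC H.
  all: assert (H0 : b 0%nat = 0).
  1,3: rewrite <- PSeries_0; apply Classical_Prop.NNPP; intros Hne;
    assert (Hp : 0 < Rabs (PSeries b 0)) by (apply Rabs_pos_lt; auto);
    assert (Hcont : continuity_pt (PSeries b) 0)
      by (apply PSeries_continuity; rewrite Rabs_R0;
          apply Rbar_lt_trans with r; auto);
    destruct (proj1 (continuity_pt_locally _ _) Hcont (mkposreal _ Hp)) as [d Hd];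
    assert (Hm : 0 < Rmin d r) by (apply Rmin_glb_lt; auto; apply cond_pos);
    assert (M1 := Rmin_l d r); assert (M2 := Rmin_r d r);
    assert (Hb : Rabs (PSeries b (- (Rmin d r / 2)) - PSeries b 0) < Rabs (PSeries b 0))
      by (apply Hd; apply Rabs_lt_between'; lra);
    rewrite H in Hb by lra; rewrite Rminus_0_l, Rabs_Ropp in Hb; lra.
  - auto.
  - apply (IH (PS_decr_1 b) r Hr).
    + rewrite CV_radius_decr_1; auto.
    + intros s Hs.
      assert (Hex : ex_pseries b s).
      { apply CV_radius_inside. apply Rbar_lt_trans with r; auto. simpl.
        apply Rabs_lt_between; lra. }
      assert (E := PSeries_decr_1 b s Hex). rewrite H, H0 in E by auto.
      assert (E' : s * PSeries (PS_decr_1 b) s = 0) by lra.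
      apply Rmult_integral in E'. destruct E'; auto; lra.
Qed.

Lemma flat_not_analytic : ~ analytic_on (fun p => flat 0 (snd p - / 2)) Bone.
Proof.
  intros HA. destruct (HA (0, / 2)) as [r [Hr [a Ha]]].
  { apply Bone_iff. lra. }
  set (b := fun n => a 0%nat n).
  assert (Hz : forall (h k : nat -> R) m,
    sum_f_R0 (fun i => h i * 0 ^ i * k i) m = h 0%nat * k 0%nat).
  { intros h k m. induction m as [|m IHm]; [simpl; ring|].
    rewrite tech5, IHm. simpl; ring. }
  assert (Hq : forall s, Rabs s < r -> ex_series (fun n => Rabs (b n) * Rabs s ^ n) /\
    flat 0 s = PSeries b s).
  { intros s Hs. destruct (Ha (0, / 2 + s)) as [H1 H2].
    { eapply Rle_lt_trans; [apply edist_le_sum|]. simpl.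
      rewrite Rminus_diag, Rabs_R0, Rplus_0_l. replace (/ 2 + s - / 2) with s by ring. auto. }
    simpl fst in *; simpl snd in *.
    replace (/ 2 + s - / 2) with s in * by ring. rewrite Rminus_diag in *. split.
    - eapply ex_series_ext; [|exact H1]. intros n. simpl. rewrite Rabs_R0.
      rewrite (Hz (fun i => Rabs (a i (n - i)%nat)) (fun i => Rabs s ^ (n - i))).
      rewrite PeanoNat.Nat.sub_0_r; auto.
    - rewrite H2. unfold PSeries. apply Series_ext. intros n.
      rewrite (Hz (fun i => a i (n - i)%nat) (fun i => s ^ (n - i))).
      rewrite PeanoNat.Nat.sub_0_r; auto. }
  assert (HC : Rbar_le (r / 2) (CV_radius b)).
  { replace (r / 2) with (Rabs (r / 2)) by (apply Rabs_pos_eq; lra).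
    apply Rbar_not_lt_le; intros Hlt. apply (CV_disk_outside _ _ Hlt).
    apply ex_series_lim_0. destruct (Hq (r / 2)) as [H1 _]; [apply Rabs_lt_between; lra|].
    refine (proj1 (Series_abs_le _ _ _ H1)).
    intros n; rewrite Rabs_mult, RPow_abs; lra. }
  assert (Hb : forall n, b n = 0).
  { intros n. apply (PSeries_left_zero n b (r / 4)); [lra| |].
    - eapply Rbar_lt_le_trans; [|exact HC]. simpl; lra.
    - intros s Hs. destruct (Hq s) as [_ <-]; [apply Rabs_lt_between; lra|].
      apply flat_neg; lra. }
  destruct (Hq (r / 2)) as [_ E]; [apply Rabs_lt_between; lra|].
  assert (F := flat_gt0 0 (r / 2) ltac:(lra)). rewrite E in F.
  unfold PSeries in F. rewrite (Series_ext _ (fun _ => 0 * 0)) in F.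
  - rewrite Series_scal_l in F; lra.
  - intros n; rewrite Hb; ring.
Qed.

Lemma nonanalytic_choice f : exists L, ~ analytic_on L Bone /\
  (L = f \/ L = fun p => f p + flat 0 (snd p - / 2)).
Proof.
  destruct (excluded_middle_informative (analytic_on f Bone)) as [H|H].
  - exists (fun p => f p + flat 0 (snd p - / 2)); split; auto. intros H'.
    apply flat_not_analytic.
    replace (fun p : pt => flat 0 (snd p - / 2)) with
      (fun p => f p + flat 0 (snd p - / 2) - f p).
    + apply analytic_minus; auto.
    + apply functional_extensionality; intros p; ring.
  - exists f; auto.
Qed.

(** * Free boundaries as graphs *)

Definition lip2 (f : pt -> R) (M : R) :=
  forall p q, Rabs (f p - f q) <= M * (Rabs (fst p - fst q) + Rabs (snd p - snd q)).

Lemma lip2_edist f M p q : 0 <= M -> lip2 f M -> Rabs (f p - f q) <= 2 * M * edist p q.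
Proof.
  intros HM H. eapply Rle_trans; [apply H|].
  assert (A := edist_fst p q). assert (B := edist_snd p q). nra.
Qed.

Lemma lip2_refl f M : lip2 f M -> lip2 (fun p => f (refl2 p)) M.
Proof.
  intros H p q. eapply Rle_trans; [apply H|]. simpl. right.
  replace (- snd p - - snd q) with (- (snd p - snd q)) by ring. rewrite Rabs_Ropp; auto.
Qed.

(* At [d = 0] Rocq's [Rpower] is positive, so the first hypothesis alone suffices there. *)
Lemma holder_half a C D d : 0 <= d -> 0 <= C -> 0 <= D -> a <= C * d -> a <= D ->
  a <= (C + D) * Rpower d (/ 2).
Proof.
  intros Hd HC HD H1 H2.
  destruct (Rle_lt_or_eq_dec 0 d Hd) as [Hp|<-].
  - rewrite Rpower_sqrt by auto. assert (S0 := sqrt_lt_R0 d Hp).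
    assert (SS := sqrt_sqrt d Hd).
    destruct (Rle_dec d 1) as [Hle|Hgt].
    + assert (sqrt d <= 1) by (rewrite <- sqrt_1; apply sqrt_le_1_alt; auto).
      assert (d <= sqrt d) by nra.
      assert (C * d <= C * sqrt d) by (apply Rmult_le_compat_l; auto).
      assert (0 <= D * sqrt d) by (apply Rmult_le_pos; lra). lra.
    + assert (1 <= sqrt d) by (rewrite <- sqrt_1; apply sqrt_le_1_alt; lra).
      assert (0 <= C * sqrt d) by (apply Rmult_le_pos; lra).
      assert (D * 1 <= D * sqrt d) by (apply Rmult_le_compat_l; auto). lra.
  - assert (0 < Rpower 0 (/ 2)) by apply exp_pos.
    assert (0 <= (C + D) * Rpower 0 (/ 2)) by (apply Rmult_le_pos; lra). lra.
Qed.

Lemma increasing_in_y U Uy x y1 y2 : has_dy U Uy -> (forall p, / 2 <= Uy p) -> y1 <= y2 ->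
  (y2 - y1) / 2 <= U (x, y2) - U (x, y1).
Proof.
  intros Hy Hm Hle.
  destruct (MVT_gen (fun t => U (x, t)) y1 y2 (fun t => Uy (x, t))) as [c [_ ->]].
  - intros t _; apply (Hy (x, t)).
  - intros t _. apply continuity_pt_filterlim, (ex_derive_continuous (fun t => U (x, t)) t).
    eexists; apply (Hy (x, t)).
  - specialize (Hm (x, c)). nra.
Qed.

Lemma implicit_graph U Ux Uy M : has_dx U Ux -> has_dy U Uy -> 0 <= M ->
  (forall p, Rabs (Ux p) <= M) -> (forall p, Rabs (Uy p) <= M) ->
  lip2 Ux M -> lip2 Uy M -> (forall p, / 2 <= Uy p) ->
  (forall p, Rabs (U p - snd p) <= / 4) ->
  exists g, C1alpha_R (/ 2) g /\ forall x y, U (x, y) > 0 <-> y > g x.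
Proof.
  intros Hx Hy M0 Bx By Lx Ly Hm H4.
  assert (Hinc := fun x y1 y2 => increasing_in_y U Uy x y1 y2 Hy Hm).
  assert (HI : forall x, exists y, U (x, y) = 0).
  { intros x. destruct (IVT (fun t => U (x, t)) (-1) 1) as [y [_ E]].
    - intros t. apply continuity_pt_filterlim, (ex_derive_continuous (fun t => U (x, t)) t).
      eexists; apply (Hy (x, t)).
    - lra.
    - specialize (H4 (x, -1)). apply Rabs_le_between in H4. simpl in H4. lra.
    - specialize (H4 (x, 1)). apply Rabs_le_between in H4. simpl in H4. lra.
    - exists y; auto. }
  set (g := fun x => proj1_sig (constructive_indefinite_description _ (HI x))).
  assert (Hg : forall x, U (x, g x) = 0)
    by (intros x; exact (proj2_sig (constructive_indefinite_description _ (HI x)))).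
  exists g. split.
  2:{ intros x y; split; intros H.
      - apply Rnot_le_gt; intros Hle. assert (A := Hinc x y (g x) Hle).
        rewrite Hg in A. lra.
      - assert (A := Hinc x (g x) y ltac:(lra)). rewrite Hg in A. lra. }
  assert (Lg : forall x x', Rabs (g x' - g x) <= 2 * M * Rabs (x' - x)).
  { intros x x'.
    assert (A : Rabs (U (x, g x) - U (x', g x)) <= M * Rabs (x - x')).
    { apply (lip_of_derive (fun t => U (t, g x)) (fun t => Ux (t, g x))); auto.
      intros t; apply (Hx (t, g x)). }
    rewrite Hg, Rminus_0_l, Rabs_Ropp, (Rabs_minus_sym x x') in A.
    assert (B : Rabs (g x' - g x) / 2 <= Rabs (U (x', g x))).
    { destruct (Rle_dec (g x) (g x')) as [H|H].
      - assert (I := Hinc x' (g x) (g x') H). rewrite Hg in I.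
        rewrite Rabs_pos_eq by lra. rewrite <- Rabs_Ropp.
        eapply Rle_trans; [|apply Rle_abs]. lra.
      - assert (I := Hinc x' (g x') (g x) ltac:(lra)). rewrite Hg in I.
        rewrite <- Rabs_Ropp, Rabs_pos_eq by lra.
        eapply Rle_trans; [|apply Rle_abs]. lra. }
    lra. }
  set (gd := fun x => - Ux (x, g x) / Uy (x, g x)).
  assert (Lf : forall f, lip2 f M -> forall x x',
    Rabs (f (x', g x') - f (x, g x)) <= M * (1 + 2 * M) * Rabs (x' - x)).
  { intros f Hf x x'. eapply Rle_trans; [apply Hf|]. simpl. specialize (Lg x x').
    rewrite Rmult_assoc. apply Rmult_le_compat_l; auto. lra. }
  exists gd; split.
  - enough (Hder : forall x : R, is_derive g x (gd x)) by exact Hder. intros x.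
    apply is_derive_of_quadratic with (2 * (M + M * (2 * M) ^ 2 + M * (2 * M))).
    intros x'. unfold gd.
    set (dx := x' - x). set (dg := g x' - g x).
    assert (T1 : Rabs (U (x', g x') - U (x, g x') - dx * Ux (x, g x')) <= M * dx ^ 2).
    { apply (taylor_of_lip (fun t => U (t, g x')) (fun t => Ux (t, g x'))).
      - intros t; apply (Hx (t, g x')).
      - intros t t'. eapply Rle_trans; [apply Lx|]. simpl.
        rewrite Rminus_diag, Rabs_R0, Rplus_0_r. lra. }
    assert (T2 : Rabs (U (x, g x') - U (x, g x) - dg * Uy (x, g x)) <= M * dg ^ 2).
    { apply (taylor_of_lip (fun t => U (x, t)) (fun t => Uy (x, t))).
      - intros t; apply (Hy (x, t)).
      - intros t t'. eapply Rle_trans; [apply Ly|]. simpl.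
        rewrite Rminus_diag, Rabs_R0, Rplus_0_l. lra. }
    assert (T3 : Rabs (Ux (x, g x') - Ux (x, g x)) <= M * Rabs dg).
    { eapply Rle_trans; [apply Lx|]. simpl.
      rewrite Rminus_diag, Rabs_R0, Rplus_0_l. unfold dg; lra. }
    assert (T4 : Rabs dg <= 2 * M * Rabs dx) by apply Lg.
    rewrite !Hg in *.
    assert (Y := Hm (x, g x)).
    replace (dg - dx * (- Ux (x, g x) / Uy (x, g x))) with
      ((dg * Uy (x, g x) + dx * Ux (x, g x)) * / Uy (x, g x)) by (field; lra).
    rewrite Rabs_mult, Rabs_inv, (Rabs_pos_eq (Uy (x, g x))) by lra.
    assert (Yi : 0 < / Uy (x, g x) <= 2).
    { split; [apply Rinv_0_lt_compat; lra|].
      rewrite <- (Rinv_inv 2). apply Rinv_le_contravar; lra. }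
    assert (dg2 : dg ^ 2 <= (2 * M) ^ 2 * dx ^ 2).
    { rewrite <- (pow2_abs dg), <- (pow2_abs dx), <- Rpow_mult_distr.
      apply pow_incr; split; auto using Rabs_pos. }
    assert (T5 : Rabs (dx * (Ux (x, g x') - Ux (x, g x))) <= M * (2 * M) * dx ^ 2).
    { rewrite Rabs_mult, <- (pow2_abs dx). assert (P := Rabs_pos dx).
      apply Rle_trans with (Rabs dx * (M * (2 * M * Rabs dx))); [|right; ring].
      apply Rmult_le_compat_l; auto. eapply Rle_trans; [exact T3|].
      apply Rmult_le_compat_l; auto. }
    assert (T6 : M * dg ^ 2 <= M * ((2 * M) ^ 2 * dx ^ 2)) by (apply Rmult_le_compat_l; auto).
    assert (N : Rabs (dg * Uy (x, g x) + dx * Ux (x, g x)) <=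
      (M + M * (2 * M) ^ 2 + M * (2 * M)) * dx ^ 2).
    { apply Rabs_le. apply Rabs_le_between in T1, T2, T5. lra. }
    assert (P := Rabs_pos (dg * Uy (x, g x) + dx * Ux (x, g x))).
    apply Rle_trans with ((M + M * (2 * M) ^ 2 + M * (2 * M)) * dx ^ 2 * 2); [|lra].
    apply Rmult_le_compat; lra.
  - exists (4 * (M * (M * (1 + 2 * M)) + M * (M * (1 + 2 * M))) + 4 * M). intros s t.
    assert (B1 : forall x, Rabs (gd x) <= 2 * M).
    { intros x. unfold gd, Rdiv. rewrite Rabs_mult, Rabs_Ropp, Rabs_inv.
      assert (Y := Hm (x, g x)). rewrite (Rabs_pos_eq (Uy (x, g x))) by lra.
      assert (Yi : 0 < / Uy (x, g x) <= 2).
      { split; [apply Rinv_0_lt_compat; lra|].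
        rewrite <- (Rinv_inv 2). apply Rinv_le_contravar; lra. }
      assert (A := Rabs_pos (Ux (x, g x))). specialize (Bx (x, g x)). nra. }
    assert (Q : 0 <= M * (M * (1 + 2 * M))) by (repeat apply Rmult_le_pos; lra).
    apply holder_half; auto using Rabs_pos; try lra.
    + unfold gd. assert (Y1 := Hm (s, g s)). assert (Y2 := Hm (t, g t)).
      assert (D1 := Lf Ux Lx t s). assert (D2 := Lf Uy Ly t s).
      assert (C1 := Bx (s, g s)). assert (C2 := By (s, g s)).
      set (a := Ux (s, g s)) in *. set (a' := Ux (t, g t)) in *.
      set (b := Uy (s, g s)) in *. set (b' := Uy (t, g t)) in *.
      set (k := Rabs (s - t)) in *.
      replace (- a / b - - a' / b') with ((a * (b - b') - b * (a - a')) * (/ b * / b'))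
        by (field; lra).
      assert (Yi : forall y, / 2 <= y -> 0 < / y <= 2).
      { intros y HY. split; [apply Rinv_0_lt_compat; lra|].
        rewrite <- (Rinv_inv 2). apply Rinv_le_contravar; lra. }
      assert (Yb := Yi b Y1). assert (Yb' := Yi b' Y2).
      rewrite Rabs_mult, (Rabs_pos_eq (/ b * / b')) by (apply Rmult_le_pos; lra).
      assert (I4 : 0 <= / b * / b' <= 4) by (split; [apply Rmult_le_pos; lra|nra]).
      assert (N : Rabs (a * (b - b') - b * (a - a')) <=
        (M * (M * (1 + 2 * M)) + M * (M * (1 + 2 * M))) * k).
      { unfold Rminus at 1. eapply Rle_trans; [apply Rabs_triang|].
        rewrite Rabs_Ropp, !Rabs_mult, Rmult_plus_distr_r.
        assert (forall z w, Rabs z <= M -> Rabs w <= M * (1 + 2 * M) * k ->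
          Rabs z * Rabs w <= M * (M * (1 + 2 * M)) * k) as Z.
        { intros z w Hz Hw. rewrite (Rmult_assoc M).
          apply Rmult_le_compat; auto using Rabs_pos. }
        apply Rplus_le_compat; apply Z; auto. }
      assert (P := Rabs_pos (a * (b - b') - b * (a - a'))).
      apply Rle_trans with ((M * (M * (1 + 2 * M)) + M * (M * (1 + 2 * M))) * k * 4); [|lra].
      apply Rmult_le_compat; lra.
    + unfold Rminus. eapply Rle_trans; [apply Rabs_triang|]. rewrite Rabs_Ropp.
      assert (A := B1 s). assert (B := B1 t). lra.
Qed.

Lemma graph_C1alpha_boundary s g Om : s = 1 \/ s = -1 -> C1alpha_R (/ 2) g ->
  (forall x y, Om (x, y) <-> Bone (x, y) /\ s * y > g x) -> C1alpha_boundary (/ 2) Om.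
Proof.
  intros Hs [gd [Hd [C HC]]] HOm [x0 y0] _ HB.
  assert (s2 : s * s = 1) by (destruct Hs as [->| ->]; ring).
  destruct (open2_Bone _ HB) as [r [Hr Hball]].
  exists r; split; auto.
  exists (s * (PI / 2)), (fun t => g (x0 - s * t) - s * y0). split.
  - exists (fun t => - s * gd (x0 - s * t)); split.
    + intros t. auto_derive; [eexists; apply Hd|].
      rewrite (is_derive_unique _ _ _ (Hd _)). unfold Rminus; ring.
    + exists C. intros a b. rewrite <- Rmult_minus_distr_l, Rabs_mult, Rabs_Ropp.
      specialize (HC (x0 - s * a) (x0 - s * b)).
      replace (x0 - s * a - (x0 - s * b)) with (s * (b - a)) in HC by ring.
      assert (As : Rabs s = 1)
        by (destruct Hs as [->| ->]; [apply Rabs_R1|rewrite Rabs_left; lra]).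
      rewrite Rabs_mult, As, Rmult_1_l in HC.
      rewrite As, Rmult_1_l, (Rabs_minus_sym a b). auto.
  - intros [x y] Hq. simpl.
    assert (Ec : cos (s * (PI / 2)) = 0).
    { destruct Hs as [->| ->]; [rewrite Rmult_1_l; apply cos_PI2|].
      replace (-1 * (PI / 2)) with (- (PI / 2)) by ring. rewrite cos_neg. apply cos_PI2. }
    assert (Es : sin (s * (PI / 2)) = s).
    { destruct Hs as [->| ->]; [rewrite Rmult_1_l; apply sin_PI2|].
      replace (-1 * (PI / 2)) with (- (PI / 2)) by ring. rewrite sin_neg, sin_PI2. ring. }
    rewrite Ec, Es. rewrite edist_sym in Hq. specialize (Hball _ Hq). split; auto.
    replace (x0 - s * (- s * (x - x0) + 0 * (y - y0))) with (x0 + s * s * (x - x0)) by ring.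
    rewrite s2. replace (x0 + 1 * (x - x0)) with x by ring.
    rewrite HOm. split; [intros [_ H]|intros H; split; auto]; lra.
Qed.

Lemma phase_regular f V Vx Vy Vxx Vyy Om M : open2 Om -> (forall p, Om p -> f p = V p) ->
  S2 2 V -> has_dx V Vx -> has_dy V Vy -> has_dx Vx Vxx -> has_dy Vy Vyy ->
  (forall p, Om p -> Vxx p + Vyy p = 0) -> 0 <= M ->
  (forall p, Rabs (Vx p) <= M) -> (forall p, Rabs (Vy p) <= M) -> lip2 Vx M -> lip2 Vy M ->
  C1alpha_upto (/ 2) f Om (fun p => (Vx p, Vy p)) /\ harmonic_on f Om.
Proof.
  intros HO Hf HS Hx Hy Hxx Hyy Hlap M0 Bx By Lx Ly.
  split; split.
  - intros p Hp. destruct (open2_lines Om p HO Hp) as [L1 L2]. split.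
    + apply is_derive_ext_loc with (fun t => V (t, snd p)); [|apply Hx].
      eapply filter_imp; [|exact L1]. intros t Ht; symmetry; apply (Hf (t, snd p) Ht).
    + apply is_derive_ext_loc with (fun t => V (fst p, t)); [|apply Hy].
      eapply filter_imp; [|exact L2]. intros t Ht; symmetry; apply (Hf (fst p, t) Ht).
  - intros p0 _ _. exists 1; split; [lra|]. exists (4 * M + 4 * M).
    intros p q _ _ _ _ _ _.
    apply holder_half; try lra; [apply edist_nonneg| |].
    + eapply Rle_trans; [apply edist_le_sum|]. simpl.
      assert (A := lip2_edist Vx M p q M0 Lx). assert (B := lip2_edist Vy M p q M0 Ly). lra.
    + eapply Rle_trans; [apply edist_le_sum|]. simpl.
      assert (T : forall a b, Rabs a <= M -> Rabs b <= M -> Rabs (a - b) <= 2 * M).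
      { intros a b Ha Hb. unfold Rminus. eapply Rle_trans; [apply Rabs_triang|].
        rewrite Rabs_Ropp; lra. }
      assert (A := T _ _ (Bx p) (Bx q)). assert (B := T _ _ (By p) (By q)). lra.
  - apply Ck_on_ext_open with V; auto. apply S2_Ck_on; auto.
  - intros p Hp. rewrite !(pdw_ext_open Om f V HO Hf) by auto.
    simpl. rewrite (Dx_eq V Vx), (Dx_eq Vx Vxx), (Dy_eq V Vy), (Dy_eq Vy Vyy); auto.
Qed.

Lemma coefficient_exists Vx Vy : (forall n, S2 n Vx) -> (forall n, S2 n Vy) ->
  (forall p, Vy p <> 0) ->
  exists L, smooth_on L Bone /\ ~ analytic_on L Bone /\ (forall p, 0 < L p) /\
    forall p, snd p <= / 2 -> sqnorm (Vx p, Vy p) = L p.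
Proof.
  intros Sx Sy HV.
  set (f := fun p => Vx p * Vx p + Vy p * Vy p).
  assert (Sf : forall n, S2 n f) by (intros n; apply S2_plus; apply S2_mult; auto).
  assert (Pf : forall p, 0 < f p).
  { intros p. unfold f. specialize (HV p). assert (0 < Vy p * Vy p) by nra.
    assert (HQ := Rle_0_sqr (Vx p)). unfold Rsqr in HQ. lra. }
  destruct (nonanalytic_choice f) as [L [HL HLe]]. exists L.
  assert (HL2 : (forall n, S2 n L) /\ (forall p, 0 < L p) /\
    forall p, snd p <= / 2 -> f p = L p).
  { destruct HLe as [->| ->]; auto. split; [|split].
    - intros n. apply S2_plus; auto.
      apply (S2_of_snd n (fun t => flat 0 (t - / 2))).
      apply Cn_ext with (fun t => flat 0 (1 * t + - / 2)).
      + intros t; f_equal; ring.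
      + apply Cn_comp_affine, Cn_flat.
    - intros p. assert (H := flat_ge0 0 (snd p - / 2)). specialize (Pf p). lra.
    - intros p Hp. rewrite flat_neg; lra. }
  destruct HL2 as [H1 [H2 H3]]. split; [|split; [|split]]; auto.
  - intros k. apply S2_Ck_on; auto.
  - intros p Hp. rewrite <- H3 by auto. unfold sqnorm, f; simpl; ring.
Qed.

Lemma superlevel_facts V L (Om : pt -> Prop) : 0 <= L ->
  (forall p q, Rabs (V p - V q) <= L * edist p q) ->
  (forall p, Om p <-> Bone p /\ V p > 0) ->
  open2 Om /\ (forall p, closure2 Om p -> 0 <= V p) /\
  (forall p, boundary2 Om p -> Bone p -> V p = 0).
Proof.
  intros HL HV HOm.
  assert (HO : open2 Om).
  { intros p Hp. apply HOm in Hp. destruct Hp as [Hb Hp].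
    destruct (open2_Bone p Hb) as [e [He H]].
    assert (Hm : 0 < Rmin e (V p / (L + 1)))
      by (apply Rmin_glb_lt; auto; apply Rdiv_lt_0_compat; lra).
    exists (Rmin e (V p / (L + 1))); split; auto. intros q Hq. apply HOm. split.
    - apply H. eapply Rlt_le_trans; [exact Hq|apply Rmin_l].
    - assert (Hq2 : edist p q < V p / (L + 1))
        by (eapply Rlt_le_trans; [exact Hq|apply Rmin_r]).
      apply Rmult_lt_compat_r with (r := L + 1) in Hq2; [|lra].
      unfold Rdiv in Hq2; rewrite Rmult_assoc, Rinv_l, Rmult_1_r in Hq2 by lra.
      specialize (HV p q). apply Rabs_le_between in HV.
      assert (A := edist_nonneg p q). nra. }
  assert (HC : forall p, closure2 Om p -> 0 <= V p).
  { intros p Hp. apply Rnot_lt_le; intros Hneg.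
    destruct (Hp (- V p / (L + 1))) as [q [Hq Hd]]; [apply Rdiv_lt_0_compat; lra|].
    apply HOm in Hq. destruct Hq as [_ Hq].
    apply Rmult_lt_compat_r with (r := L + 1) in Hd; [|lra].
    unfold Rdiv in Hd; rewrite Rmult_assoc, Rinv_l, Rmult_1_r in Hd by lra.
    specialize (HV p q). apply Rabs_le_between in HV.
    assert (A := edist_nonneg p q). nra. }
  split; [|split]; auto.
  intros p [H1 H2] Hb. apply HC in H1. destruct (Rle_lt_or_eq_dec _ _ H1) as [Hp|Hp]; auto.
  exfalso. assert (Op : Om p) by (apply HOm; auto).
  destruct (HO p Op) as [e [He H]]. destruct (H2 e He) as [q [Hn Hq]]. auto.
Qed.

Lemma closed1_boundary1 K : closed1 (boundary1 K).
Proof.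
  assert (H : forall S x, closure1 (closure1 S) x -> closure1 S x).
  { intros S x Hx e He. destruct (Hx (e / 2)) as [y [Hy H1]]; [lra|].
    destruct (Hy (e / 2)) as [z [Hz H2]]; [lra|]. exists z; split; auto.
    replace (x - z) with ((x - y) + (y - z)) by ring.
    eapply Rle_lt_trans; [apply Rabs_triang|]. lra. }
  intros x Hx. split; apply H; intros e He; destruct (Hx e He) as [y [[H1 H2] Hy]];
    exists y; auto.
Qed.

Lemma boundary1_dense_complement K x e : closed1 K -> boundary1 K x -> -1 <= x <= 1 -> 0 < e ->
  exists y, -1 < y < 1 /\ Rabs (x - y) < e /\ ~ boundary1 K y.
Proof.
  intros HK Hx Hx1 He. apply Classical_Prop.NNPP; intros Hno.
  assert (All : forall y, -1 < y < 1 -> Rabs (x - y) < e -> boundary1 K y).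
  { intros y H1 H2. apply Classical_Prop.NNPP; intros H3. apply Hno; exists y; auto. }
  set (d := Rmin (/ 2) (e / 2)).
  assert (D1 : d <= / 2) by apply Rmin_l. assert (D2 : d <= e / 2) by apply Rmin_r.
  assert (D0 : 0 < d) by (apply Rmin_glb_lt; lra).
  set (y := x * (1 - d)).
  assert (Y1 : Rabs y <= 1 - d).
  { unfold y. rewrite Rabs_mult, (Rabs_pos_eq (1 - d)) by lra.
    assert (Rabs x <= 1) by (apply Rabs_le; lra). assert (A := Rabs_pos x). nra. }
  assert (Y2 : Rabs (x - y) <= d).
  { replace (x - y) with (x * d) by (unfold y; ring).
    rewrite Rabs_mult, (Rabs_pos_eq d) by lra.
    assert (Rabs x <= 1) by (apply Rabs_le; lra). nra. }
  apply Rabs_le_between in Y1.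
  assert (By : boundary1 K y) by (apply All; lra).
  destruct By as [_ By]. destruct (By d D0) as [z [Hz Hd]].
  apply Hz. apply HK. apply (All z).
  - apply Rabs_lt_between in Hd. lra.
  - replace (x - z) with ((x - y) + (y - z)) by ring.
    eapply Rle_lt_trans; [apply Rabs_triang|]. lra.
Qed.

Lemma Rmax_0_lip a b : Rabs (Rmax a 0 - Rmax b 0) <= Rabs (a - b).
Proof.
  unfold Rmax; destruct (Rle_dec a 0), (Rle_dec b 0); unfold Rabs;
    repeat destruct Rcase_abs; lra.
Qed.

Lemma bsmooth2_lip f : bsmooth2 f -> exists M, 0 <= M /\ (forall p, Rabs (f p) <= M) /\ lip2 f M.
Proof.
  intros H. destruct (H 1%nat) as [[M HM] [fx [fy [Hx [Hy [[[Mx HMx] _] [[My HMy] _]]]]]]].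
  set (N := Rmax M (Rmax Mx My)).
  assert (L1 : M <= N) by apply Rmax_l.
  assert (L2 : Mx <= N) by (eapply Rle_trans; [apply Rmax_l|apply Rmax_r]).
  assert (L3 : My <= N) by (eapply Rle_trans; [apply Rmax_r|apply Rmax_r]).
  assert (B : forall p, Rabs (f p) <= N) by (intros p; specialize (HM p); lra).
  exists N; split; [eapply Rle_trans; [apply Rabs_pos|apply (B (0, 0))]|]. split; auto.
  intros p q. apply (lip_of_partials f fx fy); auto; intros r;
    [specialize (HMx r)|specialize (HMy r)]; lra.
Qed.

Lemma lip2_le f M N : M <= N -> lip2 f M -> lip2 f N.
Proof.
  intros H HM p q. eapply Rle_trans; [apply HM|]. apply Rmult_le_compat_r; auto.
  assert (A := Rabs_pos (fst p - fst q)). assert (B := Rabs_pos (snd p - snd q)). lra.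
Qed.

Theorem theorem1p2 :
  forall K : R -> Prop,
    (forall x, K x -> -1 <= x <= 1) -> closed1 K ->
    exists Lp Lm u : pt -> R,
      smooth_on Lp Bone /\ ~ analytic_on Lp Bone /\
      smooth_on Lm Bone /\ ~ analytic_on Lm Bone /\
      (forall p, Bone p -> 0 < Lp p /\ 0 < Lm p) /\
      two_phase_solution u Lp Lm /\
      (forall p, branching_set u p <-> (snd p = 0 /\ boundary1 K (fst p))).
Proof.
  intros K HK1 HK.
  destruct (harmonic_perturbation (boundary1 K) (closed1_boundary1 K))
    as [W [Wx [Wy [Wxx [Wyy [BW [Dx' [Dy' [Dxx [Dyy [Lap [W4 [Wy2 Wz]]]]]]]]]]]]].
  destruct (bsmooth2_partials W Wx Wy BW Dx' Dy') as [BWx BWy].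
  destruct (bsmooth2_lip Wx BWx) as [M1 [M1p [MWx LWx]]].
  destruct (bsmooth2_lip Wy BWy) as [M2 [M2p [MWy LWy]]].
  set (M := M1 + M2 + 1).
  set (U := fun p : pt => snd p + -1 * W p).
  set (Ux := fun p : pt => -1 * Wx p). set (Uy := fun p : pt => 1 + -1 * Wy p).
  set (Uxx := fun p : pt => -1 * Wxx p). set (Uyy := fun p : pt => -1 * Wyy p).
  assert (HUx : has_dx U Ux).
  { intros p. evar_last.
    - apply (is_derive_plus (fun _ => snd p) (fun t => -1 * W (t, snd p))); [apply is_derive_const|].
      apply (is_derive_scal (fun t => W (t, snd p))), Dx'.
    - apply Rplus_0_l. }
  assert (HUy : has_dy U Uy).
  { intros p. apply (is_derive_plus (fun t => t) (fun t => -1 * W (fst p, t)));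
      [auto_derive; auto|].
    apply (is_derive_scal (fun t => W (fst p, t))), Dy'. }
  assert (HUxx : has_dx Ux Uxx).
  { intros p. unfold Ux, Uxx. apply (is_derive_scal (fun t => Wx (t, snd p))); apply Dxx. }
  assert (HUyy : has_dy Uy Uyy).
  { intros p. evar_last.
    - apply (is_derive_plus (fun _ => 1) (fun t => -1 * Wy (fst p, t))); [apply is_derive_const|].
      apply (is_derive_scal (fun t => Wy (fst p, t))), Dyy.
    - apply Rplus_0_l. }
  assert (SW : forall n, S2 n W) by (intros; apply BS2_S2, BW).
  assert (SU : forall n, S2 n U).
  { intros n; apply S2_plus; [apply S2_snd|]. apply S2_mult; auto using S2_const. }
  assert (SUx : forall n, S2 n Ux).
  { intros n; apply S2_mult; auto using S2_const. apply BS2_S2, BWx. }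
  assert (SUy : forall n, S2 n Uy).
  { intros n; apply S2_plus; auto using S2_const. apply S2_mult; auto using S2_const.
    apply BS2_S2, BWy. }
  assert (HUyh : forall p, / 2 <= Uy p).
  { intros p. specialize (Wy2 p). apply Rabs_le_between in Wy2. unfold Uy. lra. }
  assert (Mp : 0 <= M) by (unfold M; lra).
  assert (BUx : forall p, Rabs (Ux p) <= M).
  { intros p. unfold Ux, M. replace (-1 * Wx p) with (- Wx p) by ring. rewrite Rabs_Ropp.
    specialize (MWx p). lra. }
  assert (BUy : forall p, Rabs (Uy p) <= M).
  { intros p. unfold Uy, M. eapply Rle_trans; [apply Rabs_triang|].
    rewrite Rabs_R1. replace (-1 * Wy p) with (- Wy p) by ring. rewrite Rabs_Ropp.
    specialize (MWy p). lra. }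
  assert (LUx : lip2 Ux M).
  { apply lip2_le with M1; [unfold M; lra|]. intros p q. unfold Ux.
    replace (-1 * Wx p - -1 * Wx q) with (- (Wx p - Wx q)) by ring. rewrite Rabs_Ropp; auto. }
  assert (LUy : lip2 Uy M).
  { apply lip2_le with M2; [unfold M; lra|]. intros p q. unfold Uy.
    replace (1 + -1 * Wy p - (1 + -1 * Wy q)) with (- (Wy p - Wy q)) by ring.
    rewrite Rabs_Ropp; auto. }
  assert (LU : lip2 U M) by (intros p q; apply (lip_of_partials U Ux Uy); auto).
  assert (HU4 : forall p, Rabs (U p - snd p) <= / 4).
  { intros p. unfold U. replace (snd p + -1 * W p - snd p) with (- W p) by ring.
    rewrite Rabs_Ropp; auto. }
  assert (Hinc := fun x y1 y2 => increasing_in_y U Uy x y1 y2 HUy HUyh).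
  assert (U0 : forall x, -1 <= x <= 1 -> U (x, 0) <= 0 /\ (U (x, 0) = 0 <-> boundary1 K x)).
  { intros x Hx. destruct (Wz x Hx) as [A B]. unfold U; simpl. split; [lra|].
    rewrite <- B. split; lra. }
  assert (Upos : forall x y, -1 <= x <= 1 -> 0 <= U (x, y) -> 0 <= y).
  { intros x y Hx H. apply Rnot_lt_le; intros Hn. destruct (U0 x Hx) as [A _].
    assert (B := Hinc x y 0 ltac:(lra)). lra. }
  assert (Uneg : forall x y, -1 <= x <= 1 -> 0 <= y -> U (x, - y) <= 0).
  { intros x y Hx H. destruct (U0 x Hx) as [A _].
    assert (B := Hinc x (- y) 0 ltac:(lra)). lra. }
  assert (Bx : forall x y, Bone (x, y) -> -1 <= x <= 1).
  { intros x y H. apply Bone_iff in H. assert (A := pow2_ge_0 y). nra. }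
  set (V := fun p => U (refl2 p)).
  set (Vx := fun p => Ux (refl2 p)). set (Vy := fun p => -1 * Uy (refl2 p)).
  set (Vxx := fun p => Uxx (refl2 p)). set (Vyy := fun p => Uyy (refl2 p)).
  assert (HVx : has_dx V Vx) by (apply has_dx_refl; auto).
  assert (HVy : has_dy V Vy) by (apply has_dy_refl; auto).
  assert (HVxx : has_dx Vx Vxx) by (apply has_dx_refl; auto).
  assert (HVyy : has_dy Vy Vyy).
  { intros p. unfold Vy, Vyy. replace (Uyy (refl2 p)) with (-1 * (-1 * Uyy (refl2 p))) by ring.
    apply (is_derive_scal (fun t => Uy (refl2 (fst p, t)))).
    apply (has_dy_refl Uy Uyy HUyy p). }
  assert (BVy : forall p, Rabs (Vy p) <= M).
  { intros p. unfold Vy. replace (-1 * Uy (refl2 p)) with (- Uy (refl2 p)) by ring.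
    rewrite Rabs_Ropp; auto. }
  assert (LVy : lip2 Vy M).
  { intros p q. unfold Vy.
    replace (-1 * Uy (refl2 p) - -1 * Uy (refl2 q)) with (- (Uy (refl2 p) - Uy (refl2 q)))
      by ring. rewrite Rabs_Ropp. apply (lip2_refl Uy M LUy). }
  set (u := fun p => Rmax (U p) 0 - Rmax (V p) 0).
  assert (uU : forall p, Bone p -> 0 <= snd p -> u p = Rmax (U p) 0).
  { intros [x y] Hb Hy. unfold u, V, refl2; simpl in *.
    rewrite (Rmax_right (U (x, - y))) by (apply Uneg; eauto). ring. }
  assert (uV : forall p, Bone p -> snd p <= 0 -> u p = - Rmax (V p) 0).
  { intros [x y] Hb Hy. unfold u; simpl in *.
    rewrite (Rmax_right (U (x, y))).
    - ring.
    - rewrite <- (Ropp_involutive y). apply Uneg; [eauto|lra]. }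
  assert (OP : forall p, Omp u p <-> Bone p /\ U p > 0).
  { intros [x y]; unfold Omp; split; intros [A B]; split; auto.
    - unfold u in A. assert (C := Rmax_r (V (x, y)) 0).
      assert (D : 0 < Rmax (U (x, y)) 0) by lra. unfold Rmax in D.
      destruct (Rle_dec (U (x, y)) 0); lra.
    - rewrite uU; auto.
      + rewrite Rmax_left; lra.
      + apply (Upos x y); [eauto|lra]. }
  assert (OM : forall p, Omm u p <-> Bone p /\ V p > 0).
  { intros [x y]; unfold Omm; split; intros [A B]; split; auto.
    - unfold u in A. assert (C := Rmax_r (U (x, y)) 0).
      assert (D : 0 < Rmax (V (x, y)) 0) by lra. unfold Rmax in D.
      destruct (Rle_dec (V (x, y)) 0); lra.
    - rewrite uV; auto.
      + rewrite Rmax_left; lra.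
      + assert (0 <= - y) by (apply (Upos x); [eauto|unfold V, refl2 in B; simpl in B; lra]).
        simpl; lra. }
  assert (EU : forall p q, Rabs (U p - U q) <= 2 * M * edist p q)
    by (intros; apply lip2_edist; auto).
  assert (EV : forall p q, Rabs (V p - V q) <= 2 * M * edist p q)
    by (intros; apply lip2_edist; auto; apply (lip2_refl U M LU)).
  destruct (superlevel_facts U (2 * M) (Omp u)) as [OPo [OPc OPb]]; auto; [lra|].
  destruct (superlevel_facts V (2 * M) (Omm u)) as [OMo [OMc OMb]]; auto; [lra|].
  assert (uposU : forall p, Omp u p -> upos u p = U p).
  { intros [x y] H. apply OP in H. destruct H as [A B]. unfold upos.
    rewrite uU; auto.
    - rewrite (Rmax_left (U (x, y)) 0), Rmax_left; lra.
    - apply (Upos x y); [eauto|lra]. }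
  assert (unegV : forall p, Omm u p -> uneg u p = V p).
  { intros [x y] H. apply OM in H. destruct H as [A B]. unfold uneg.
    rewrite uV; auto.
    - rewrite Ropp_involutive, (Rmax_left (V (x, y)) 0), Rmax_left; lra.
    - assert (0 <= - y) by (apply (Upos x); [eauto|unfold V, refl2 in B; simpl in B; lra]).
      simpl; lra. }
  destruct (implicit_graph U Ux Uy M) as [g [Cg Hg]]; auto.
  destruct (phase_regular (upos u) U Ux Uy Uxx Uyy (Omp u) M) as [R1 R2]; auto.
  { intros [x y] H. apply OP in H. destruct H as [A B]. unfold Uxx, Uyy.
    assert (0 < y).
    { destruct (Rle_lt_or_eq_dec 0 y) as [C|C]; auto.
      - apply (Upos x y); [eauto|lra].
      - subst y. destruct (U0 x (Bx _ _ A)). lra. }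
    assert (L := Lap (x, y) H). lra. }
  destruct (phase_regular (uneg u) V Vx Vy Vxx Vyy (Omm u) M) as [R3 R4]; auto.
  { apply S2_refl; auto. }
  { intros [x y] H. apply OM in H. destruct H as [A B]. unfold Vxx, Vyy, Uxx, Uyy.
    change (U (x, - y) > 0) in B. assert (0 < - y).
    { destruct (Rle_lt_or_eq_dec 0 (- y)) as [C|C]; auto.
      - apply (Upos x (- y)); [eauto|lra].
      - rewrite <- C in B. destruct (U0 x (Bx _ _ A)). lra. }
    assert (L := Lap (x, - y) H). unfold refl2; simpl; lra. }
  { intros p; apply BUx. }
  { apply (lip2_refl Ux M LUx). }
  destruct (coefficient_exists Ux Uy) as [Lp [Lp1 [Lp2 [Lp3 Lp4]]]]; auto.
  { intros p. specialize (HUyh p). lra. }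
  destruct (coefficient_exists Vx Vy) as [Lm [Lm1 [Lm2 [Lm3 Lm4]]]].
  { intros n; apply S2_refl; auto. }
  { intros n; apply S2_mult; [apply S2_const|apply S2_refl; auto]. }
  { intros p. unfold Vy. specialize (HUyh (refl2 p)). lra. }
  assert (EP : forall p, boundary2 (Omp u) p -> Bone p -> sqnorm (Ux p, Uy p) = Lp p).
  { intros p Hp Hb. apply Lp4. assert (E := OPb p Hp Hb). assert (F := HU4 p).
    rewrite E in F. apply Rabs_le_between in F. lra. }
  assert (EM : forall p, boundary2 (Omm u) p -> Bone p -> sqnorm (Vx p, Vy p) = Lm p).
  { intros p Hp Hb. apply Lm4. assert (E := OMb p Hp Hb). assert (F := HU4 (refl2 p)).
    fold (V p) in F. rewrite E in F. apply Rabs_le_between in F. simpl in F. lra. }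
  exists Lp, Lm, u.
  do 4 (split; [assumption|]). split; [auto|]. split.
  - split.
    { exists (2 * M + 2 * M). intros p q _ _. unfold u.
      replace (Rmax (U p) 0 - Rmax (V p) 0 - (Rmax (U q) 0 - Rmax (V q) 0)) with
        ((Rmax (U p) 0 - Rmax (U q) 0) - (Rmax (V p) 0 - Rmax (V q) 0)) by ring.
      unfold Rminus at 1. eapply Rle_trans; [apply Rabs_triang|]. rewrite Rabs_Ropp.
      assert (A := Rmax_0_lip (U p) (U q)). assert (B := Rmax_0_lip (V p) (V q)).
      specialize (EU p q). specialize (EV p q). lra. }
    exists (/ 2). split; [lra|].
    split.
    { apply (graph_C1alpha_boundary 1 g); auto. intros x y. rewrite OP, Hg, Rmult_1_l. tauto. }
    split.
    { apply (graph_C1alpha_boundary (-1) g); auto. intros x y. rewrite OM.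
      unfold V, refl2; simpl. rewrite Hg. replace (-1 * y) with (- y) by ring. tauto. }
    exists (fun p => (Ux p, Uy p)), (fun p => (Vx p, Vy p)).
    do 4 (split; [assumption|]).
    split; [|split; [|split; [|split]]].
    + intros [x y] Hp Hb. unfold upos. assert (E := OPb _ Hp Hb). rewrite uU; auto.
      * rewrite E, (Rmax_left 0 0), Rmax_left; lra.
      * apply (Upos x y); [eauto|lra].
    + intros [x y] Hp Hb. unfold uneg. assert (E := OMb _ Hp Hb). rewrite uV; auto.
      * rewrite E, Ropp_involutive, (Rmax_left 0 0), Rmax_left; lra.
      * assert (0 <= - y) by (apply (Upos x); [eauto|unfold V, refl2 in E; simpl in E; lra]).
        simpl; lra.
    + auto.
    + auto.
    + intros p H1 H2 Hb. rewrite EP, EM by auto. lra.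
  - intros [x y]; simpl. split.
    + intros [[H1 _] [[H2 _] _]].
      assert (Hx : -1 <= x <= 1).
      { assert (A : Rabs x <= 1).
        { apply Rnot_lt_le; intros Hn. destruct (H1 (Rabs x - 1)) as [[x' y'] [Hq Hd]]; [lra|].
          apply OP in Hq. destruct Hq as [Hq _]. apply Bx in Hq.
          assert (F := edist_fst (x, y) (x', y')). simpl in F.
          assert (G := Rabs_triang_inv x x').
          assert (Rabs x' <= 1) by (apply Rabs_le; lra). lra. }
        apply Rabs_le_between in A; lra. }
      apply OPc in H1. apply OMc in H2. unfold V, refl2 in H2; simpl in H2.
      assert (Y1 := Upos x y Hx H1). assert (Y2 := Upos x (- y) Hx H2).
      assert (y = 0) by lra. subst y. split; auto.
      destruct (U0 x Hx) as [A B]. apply B. lra.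
    + intros [-> Hb].
      assert (Hx : -1 <= x <= 1) by (apply HK1, HK; apply Hb).
      assert (Ux0 : U (x, 0) = 0) by (apply U0; auto).
      assert (Vx0 : V (x, 0) = 0) by (unfold V, refl2; simpl; rewrite Ropp_0; auto).
      (* The parabolic approach [((1 - t^2) x, t)] stays in the disc even when [x = 1] or [x = -1],
         and beats the Lipschitz graph for small [t]. *)
      assert (App : forall e, 0 < e -> exists t, 0 < t /\
        Bone ((1 - t ^ 2) * x, t) /\ Bone ((1 - t ^ 2) * x, - t) /\
        U ((1 - t ^ 2) * x, t) > 0 /\ t ^ 2 * Rabs x + t < e).
      { intros e He. set (t := Rmin (/ 2) (Rmin (e / 4) (/ (4 * (M + 1))))).
        assert (T1 : t <= / 2) by apply Rmin_l.
        assert (T2 : t <= e / 4) by (eapply Rle_trans; [apply Rmin_r|apply Rmin_l]).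
        assert (T3 : t <= / (4 * (M + 1))) by (eapply Rle_trans; [apply Rmin_r|apply Rmin_r]).
        assert (T0 : 0 < t).
        { repeat apply Rmin_glb_lt; try lra. apply Rinv_0_lt_compat; lra. }
        assert (T4 : t * (4 * (M + 1)) <= 1).
        { apply Rmult_le_compat_r with (r := 4 * (M + 1)) in T3; [|lra].
          rewrite Rinv_l in T3 by lra. auto. }
        assert (X1 : Rabs x <= 1) by (apply Rabs_le; lra).
        assert (X0 := Rabs_pos x).
        assert (X2 : x ^ 2 <= 1) by nra.
        assert (Tt : 0 < t ^ 2 <= / 4) by (simpl; split; nra).
        assert (Bn : ((1 - t ^ 2) * x) ^ 2 + t ^ 2 < 1).
        { rewrite Rpow_mult_distr.
          assert ((1 - t ^ 2) ^ 2 * x ^ 2 <= (1 - t ^ 2) ^ 2 * 1)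
            by (apply Rmult_le_compat_l; auto; apply pow2_ge_0). nra. }
        exists t; split; auto. split; [|split; [|split]].
        - apply Bone_iff; auto.
        - apply Bone_iff. replace ((- t) ^ 2) with (t ^ 2) by ring. auto.
        - assert (I := Hinc ((1 - t ^ 2) * x) 0 t ltac:(lra)).
          assert (L : Rabs (U ((1 - t ^ 2) * x, 0) - U (x, 0)) <= M * (t ^ 2 * Rabs x)).
          { eapply Rle_trans; [apply LU|]. cbn [fst snd].
            replace ((1 - t ^ 2) * x - x) with (- (t ^ 2 * x)) by ring.
            rewrite Rminus_diag, Rabs_R0, Rplus_0_r, Rabs_Ropp, Rabs_mult.
            rewrite (Rabs_pos_eq (t ^ 2)) by lra. lra. }
          rewrite Ux0 in L. apply Rabs_le_between in L.
          assert (M * (t ^ 2 * Rabs x) <= M * t ^ 2).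
          { apply Rmult_le_compat_l; auto. nra. }
          assert (M * t ^ 2 < t / 2) by (simpl; nra). lra.
        - assert (t ^ 2 * Rabs x <= t) by (simpl; nra). lra. }
      split; [split|split; [split|]].
      * intros e He. destruct (App e He) as [t [T0 [B1 [_ [HU Hd]]]]].
        exists ((1 - t ^ 2) * x, t). split; [apply OP; auto|].
        eapply Rle_lt_trans; [apply edist_le_sum|]. cbn [fst snd].
        replace (x - (1 - t ^ 2) * x) with (t ^ 2 * x) by ring.
        rewrite Rabs_mult, (Rabs_pos_eq (t ^ 2)) by apply pow2_ge_0.
        rewrite Rminus_0_l, Rabs_Ropp, (Rabs_pos_eq t) by lra. lra.
      * intros e He. exists (x, 0). rewrite edist_self. split; auto.
        rewrite OP. lra.
      * intros e He. destruct (App e He) as [t [T0 [_ [B1 [HU Hd]]]]].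
        exists ((1 - t ^ 2) * x, - t). split.
        { apply OM. split; auto. unfold V, refl2; cbn [fst snd].
          rewrite Ropp_involutive; auto. }
        eapply Rle_lt_trans; [apply edist_le_sum|]. cbn [fst snd].
        replace (x - (1 - t ^ 2) * x) with (t ^ 2 * x) by ring.
        rewrite Rabs_mult, (Rabs_pos_eq (t ^ 2)) by apply pow2_ge_0.
        rewrite Rminus_0_l, Ropp_involutive, (Rabs_pos_eq t) by lra. lra.
      * intros e He. exists (x, 0). rewrite edist_self. split; auto.
        rewrite OM. lra.
      * intros e He.
        destruct (boundary1_dense_complement K x e HK Hb Hx He) as [z [Hz [Hd Hn]]].
        exists (z, 0). split.
        2:{ eapply Rle_lt_trans; [apply edist_le_sum|]. simpl.
            rewrite Rminus_diag, Rabs_R0, Rplus_0_r. auto. }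
        destruct (U0 z ltac:(lra)) as [A B].
        assert (Uz : U (z, 0) < 0) by (destruct (Rle_lt_or_eq_dec _ _ A); tauto).
        assert (Vz : V (z, 0) = U (z, 0)) by (unfold V, refl2; simpl; rewrite Ropp_0; auto).
        assert (Bz : Bone (z, 0)) by (apply Bone_iff; nra).
        destruct (open2_Bone _ Bz) as [r [Hr Hball]].
        set (d := - U (z, 0) / (2 * M + 1)).
        assert (Hdp : 0 < d) by (apply Rdiv_lt_0_compat; lra).
        exists (Rmin r d). split; [apply Rmin_glb_lt; auto|]. intros q Hq.
        split; [apply Hball; eapply Rlt_le_trans; [exact Hq|apply Rmin_l]|].
        assert (Hq2 : edist (z, 0) q < d) by (eapply Rlt_le_trans; [exact Hq|apply Rmin_r]).
        apply Rmult_lt_compat_r with (r := 2 * M + 1) in Hq2; [|lra].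
        unfold d, Rdiv in Hq2; rewrite Rmult_assoc, Rinv_l, Rmult_1_r in Hq2 by lra.
        assert (P := edist_nonneg (z, 0) q).
        assert (E1 := EU (z, 0) q). assert (E2 := EV (z, 0) q).
        apply Rabs_le_between in E1, E2.
        unfold u. rewrite !Rmax_right; lra.
Qed.
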